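(* For $u\in S^{k,n}$ and $w=[i_1\ldots i_ki_{k+1}\ldots i_n]\in S^{k,n}$ define an $R[q^{\pm1}]$-bilinear operation on $\bigwedge^kV[q^{\pm1}]$ by $$|u\rangle\circledast|w\rangle:=\sum_{T(u)}(t^{\rho_1}.\psi^*_{i_1})\circ(t^{\rho_2}.\psi^*_{i_2})\circ\cdots\circ(t^{\rho_k}.\psi^*_{i_k}).1,$$ where the sum runs over all semi-standard tableaux of shape $\lambda=\lambda(u)$, i.e. sequences of partitions $\emptyset=\lambda^{(0)}\subset\lambda^{(1)}\subset\cdots\subset\lambda^{(k)}=\lambda$ such that $\rho_{k+1-i}=\lambda^{(i)}/\lambda^{(i-1)}$ is a horizontal strip and $\lambda^{(i)}$ fits into the rectangle $i\times(n-i)$, and $t^{\rho_i}=\prod_{\square\in\rho_i}t_{k+1-i+c(\square)}$. Then $\circledast$ is an associative and commutative product which coincides with the quantum product $\star$ on $\bigwedge^kV[q^{\pm1}]$ given by $|u\rangle\star|w\rangle=s_{\lambda(u)}(X_1^q,\ldots,X_k^q|y)|w\rangle$. In particular, the map $|w\rangle\mapsto\sigma_w$ is an isomorphism of $R[q^{\pm1}]$-algebras $(\bigwedge^kV[q^{\pm1}],\circledast)\to qH_T^*(\mathrm{Gr}(k;n))$.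
   Context: Fix $n\ge2$ and $1\le k\le n$. Let $R=\mathbb{Z}[y_1,\ldots,y_n]$, and $y_j:=0$ for $j>n$. $S^{k,n}\subset S_n$ is the set of Grassmannian permutations $w=[w_1\ldots w_n]$ (one-line notation), i.e. $w_1<\cdots<w_k$ and $w_{k+1}<\cdots<w_n$; they are in bijection with partitions $\lambda(w)$ inside the $k\times(n-k)$ rectangle via $w_j=\lambda_{k+1-j}+j$. Put $(x|y)^m=\prod_{i=1}^m(x-y_i)$, $s_\lambda(x_1,\ldots,x_k|y)=\det\big((x_j|y)^{\lambda_i+k-i}\big)_{1\le i,j\le k}/\prod_{i<j}(x_i-x_j)$ (factorial Schur polynomial) and $h_r=s_{(r)}(x_1,\ldots,x_k|y)$. The equivariant quantum cohomology ring is $$qH_T^*(\mathrm{Gr}(k;n))=R[q^{\pm1}][x_1,\ldots,x_k]^{S_k}/\langle h_{n-k+1},\ldots,h_{n-1},h_n+(-1)^kq\rangle ,$$ with $R[q^{\pm1}]$-basis the Schubert classes $\sigma_w$ = class of $s_{\lambda(w)}(x_1,\ldots,x_k|y)$. $V=R^n$ with standard basis $v_1,\ldots,v_n$; $V[q^{\pm1}]$ etc. denote extension of scalars to $R[q^{\pm1}]$; $|w\rangle=v_{w_1}\wedge\cdots\wedge v_{w_k}$. (The paper writes $\bigwedge^kV[z^{\pm1}]/\langle z+(-1)^kq\rangle$, i.e. the loop parameter $z$ is specialised to $z=(-1)^{k-1}q$.) The matrix $$X^q=z\,E_{1,n}+\sum_{i=1}^{n-1}E_{i+1,i}+\sum_{i=1}^ny_iE_{ii},\quad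 z=(-1)^{k-1}q,\quad E_{ij}v_j=v_i,$$ acts on the $i$-th factor of $V^{\otimes k}[q^{\pm1}]$ as $X_i^q$; symmetric polynomials in the $X_i^q$ descend to $\bigwedge^kV[q^{\pm1}]$. $\psi_i^*=v_i\wedge\cdot$ on $\bigwedge V[q^{\pm1}]$, $1\le i\le n$, and $1\in\bigwedge^0V[q^{\pm1}]=R[q^{\pm1}]$. The commuting translations act $R[q^{\pm1}]$-linearly on the span of the $\psi^*_i$ by $t_j.\psi^*_i=\psi^*_{i+1}+(y_i-y_j)\psi^*_i$ with $\psi^*_{n+1}:=z\psi^*_1$, $z=(-1)^{k-1}q$ (the same $z$ for all factors in the product). A skew diagram is a horizontal strip if it has at most one box in each column. The content is $c(\square)=$ column minus row of $\square$. *)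

(* Defs.v *)
From HB Require Import structures.
From mathcomp Require Import all_boot all_order all_fingroup all_algebra.
From mathcomp Require Import generic_quotient ring_quotient.
From mathcomp Require Import boolp.
From mathcomp Require Import mpoly.

Set Implicit Arguments.
Unset Strict Implicit.
Unset Printing Implicit Defensive.

Import Order.TTheory GRing.Theory.
Local Open Scope ring_scope.

Section LaurentRing.
Variable n : nat.

Definition laurent_pred : {pred {fraction {poly {mpoly int[n]}}}} :=
  fun x => `[< exists (m : nat) (p : {poly {mpoly int[n]}}),
                 x * (tofrac 'X) ^+ m = tofrac p >].

Lemma laurent_subring_closed : subring_closed laurent_pred.
Proof.
split.
- by apply/asboolP; exists 0%N, 1; rewrite expr0 mulr1 tofrac1.
- move=> x y /asboolP[m [p xm]] /asboolP[l [r yl]].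
  apply/asboolP; exists (m + l)%N, (p * 'X^l - r * 'X^m).
  rewrite tofracB !tofracM !tofracXn -xm -yl mulrBl exprD !mulrA.
  by rewrite [in X in _ - X]mulrAC.
- move=> x y /asboolP[m [p xm]] /asboolP[l [r yl]].
  apply/asboolP; exists (m + l)%N, (p * r).
  by rewrite tofracM -xm -yl exprD mulrACA.
Qed.

HB.instance Definition _ :=
  GRing.isSubringClosed.Build {fraction {poly {mpoly int[n]}}} laurent_pred
    laurent_subring_closed.

(* Z[y_1, ..., y_n][q, q^-1], realised inside the fraction field of
   Z[y_1, ..., y_n][q] as the set of all p / q^m. *)
Record laurent : predArgType := Laurent {
  laurent_val :> {fraction {poly {mpoly int[n]}}};
  _ : laurent_val \in laurent_pred
}.

HB.instance Definition _ := [isSub for laurent_val].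
HB.instance Definition _ := [Choice of laurent by <:].
HB.instance Definition _ := [SubChoice_isSubComNzRing of laurent by <:].

Lemma tofrac_laurent (p : {poly {mpoly int[n]}}) : tofrac p \in laurent_pred.
Proof. by apply/asboolP; exists 0%N, p; rewrite expr0 mulr1. Qed.

Definition laurent_of_poly (p : {poly {mpoly int[n]}}) : laurent :=
  Laurent (tofrac_laurent p).

Definition qvar : laurent := laurent_of_poly 'X.

(* Indexed from 1; y_j = 0 for j > n (and for j = 0, which never
   occurs). *)
Definition yvar (j : nat) : laurent :=
  if j is j'.+1 then
    if insub j' is Some i then laurent_of_poly ('X_i)%:P else 0
  else 0.

Lemma qvar_invertible : exists q', qvar * q' = 1.
Proof.
have qinvP : (tofrac ('X : {poly {mpoly int[n]}}))^-1 \in laurent_pred.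
  apply/asboolP; exists 1%N, 1; rewrite expr1 tofrac1 mulVf //.
  by rewrite tofrac_eq0 polyX_eq0.
exists (Laurent qinvP); apply/val_inj => /=.
by rewrite divff // tofrac_eq0 polyX_eq0.
Qed.

End LaurentRing.

Section SymmetricPolynomials.
Variables (k : nat) (L : comNzRingType).

Record sympoly : predArgType := SymPoly {
  sympoly_val :> {mpoly L[k]};
  _ : sympoly_val \is symmetric
}.

HB.instance Definition _ := [isSub for sympoly_val].
HB.instance Definition _ := [Choice of sympoly by <:].
HB.instance Definition _ := [SubChoice_isSubComNzRing of sympoly by <:].
HB.instance Definition _ := [SubZmodule_isSubLmodule of sympoly by <:].
HB.instance Definition _ :=
  [SubNzRing_SubLmodule_isSubLalgebra of sympoly by <:].
HB.instance Definition _ := [SubLalgebra_isSubAlgebra of sympoly by <:].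

End SymmetricPolynomials.

Section IdealQuotient.
Variables (L : comNzRingType) (A : comAlgType L) (gens : seq A).

Definition gen_ideal : {pred A} :=
  fun a => `[< exists c : nat -> A,
                 a = \sum_(i < size gens) c i * gens`_i >].

Lemma gen_ideal_zmod_closed : zmod_closed gen_ideal.
Proof.
split=> [|a b /asboolP[c ->] /asboolP[d ->]]; apply/asboolP.
  by exists (fun=> 0); rewrite big1 // => i _; rewrite mul0r.
exists (fun i => c i - d i); rewrite -sumrB.
by apply: eq_bigr => i _; rewrite mulrBl.
Qed.

HB.instance Definition _ :=
  GRing.isZmodClosed.Build A gen_ideal gen_ideal_zmod_closed.

Lemma gen_idealMr a b : b \in gen_ideal -> a * b \in gen_ideal.
Proof.
move=> /asboolP[c ->]; apply/asboolP; exists (fun i => a * c i).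
by rewrite mulr_sumr; apply: eq_bigr => i _; rewrite mulrA.
Qed.

Local Open Scope quotient_scope.

(* The library only builds a ring structure on quotients by proper ideals;
   here the quotient is equipped with one for an arbitrary ideal, which is why
   it is a [comPzRingType]. *)
Definition gen_quot : Type := Quotient.quot gen_ideal.

HB.instance Definition _ := GRing.Zmodule.on gen_quot.

Definition gen_class (a : A) : gen_quot := \pi_(Quotient.quot gen_ideal) a.

Lemma gen_class_eq a b : (gen_class a == gen_class b) = (a - b \in gen_ideal).
Proof. by rewrite /gen_class Quotient.idealrBE. Qed.

Definition gen_repr (x : gen_quot) : A :=
  repr (x : Quotient.quot gen_ideal).

Lemma gen_class_repr (x : gen_quot) : gen_class (gen_repr x) = x.
Proof. exact: reprK. Qed.

Lemma gen_classD : {morph gen_class : a b / a + b}.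
Proof. by move=> a b; rewrite /gen_class Quotient.pi_add. Qed.

Definition gen_mul (x y : gen_quot) := gen_class (gen_repr x * gen_repr y).
Definition gen_scale (c : L) (x : gen_quot) := gen_class (c *: gen_repr x).

Lemma gen_classM a b : gen_mul (gen_class a) (gen_class b) = gen_class (a * b).
Proof.
apply/eqP; rewrite gen_class_eq.
have Ha : gen_repr (gen_class a) - a \in gen_ideal.
  by rewrite -gen_class_eq gen_class_repr.
have Hb : gen_repr (gen_class b) - b \in gen_ideal.
  by rewrite -gen_class_eq gen_class_repr.
set a' := gen_repr _ in Ha *; set b' := gen_repr _ in Hb *.
have -> : a' * b' - a * b = b' * (a' - a) + a * (b' - b).
  by rewrite !mulrBr addrA [b' * a]mulrC subrK [b' * a']mulrC.
by rewrite rpredD ?gen_idealMr.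
Qed.

Lemma gen_classZ c a : gen_scale c (gen_class a) = gen_class (c *: a).
Proof.
apply/eqP; rewrite gen_class_eq -scalerBr -mulr_algl gen_idealMr //.
by rewrite -gen_class_eq gen_class_repr.
Qed.

Lemma gen_mulA : associative gen_mul.
Proof.
move=> x y z; rewrite -[x]gen_class_repr -[y]gen_class_repr.
by rewrite -[z]gen_class_repr !gen_classM mulrA.
Qed.

Lemma gen_mulC : commutative gen_mul.
Proof. by move=> x y; rewrite /gen_mul mulrC. Qed.

Lemma gen_mul1 : left_id (gen_class 1) gen_mul.
Proof. by move=> x; rewrite -[x]gen_class_repr gen_classM mul1r. Qed.

Lemma gen_mulDl : left_distributive gen_mul +%R.
Proof.
move=> x y z; rewrite -[x]gen_class_repr -[y]gen_class_repr.
by rewrite -[z]gen_class_repr -gen_classD !gen_classM -gen_classD mulrDl.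
Qed.

HB.instance Definition _ := GRing.Zmodule_isComPzRing.Build gen_quot
  gen_mulA gen_mulC gen_mul1 gen_mulDl.

Lemma gen_scaleA a b x : gen_scale a (gen_scale b x) = gen_scale (a * b) x.
Proof. by rewrite -[x]gen_class_repr !gen_classZ scalerA. Qed.

Lemma gen_scale1 : left_id 1 gen_scale.
Proof. by move=> x; rewrite -[x]gen_class_repr gen_classZ scale1r. Qed.

Lemma gen_scaleDr : right_distributive gen_scale +%R.
Proof.
move=> c x y; rewrite -[x]gen_class_repr -[y]gen_class_repr.
by rewrite -gen_classD !gen_classZ -gen_classD scalerDr.
Qed.

Lemma gen_scaleDl x : {morph gen_scale^~ x : a b / a + b}.
Proof.
move=> a b; rewrite -[x]gen_class_repr !gen_classZ -gen_classD.
by rewrite scalerDl.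
Qed.

HB.instance Definition _ := GRing.Zmodule_isLmodule.Build L gen_quot
  gen_scaleA gen_scale1 gen_scaleDr gen_scaleDl.

Lemma gen_scaleAl c (x y : gen_quot) : c *: (x * y) = (c *: x) * y.
Proof.
rewrite -[x]gen_class_repr -[y]gen_class_repr /GRing.scale /GRing.mul /=.
by rewrite gen_classM !gen_classZ gen_classM scalerAl.
Qed.

End IdealQuotient.

Section FactorialSchur.
Variable k : nat.

Lemma alternant_dvd (B : comNzRingType) (m : nat) (b : 'I_m -> B)
    (f : 'I_m -> {poly B}) :
  exists s, s * \prod_(i < m) \prod_(j < m | (i < j)%N) (b i - b j)
            = \det (\matrix_(i, j) (f i).[b j]).
Proof.
elim: m => [|m IHm] in b f *.
  by exists 1; rewrite big_ord0 det_mx00 mulr1.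
have fE i : exists g, f i = (f i).[b ord0]%:P + g * ('X - (b ord0)%:P).
  have /factor_theorem[g gE] : root (f i - (f i).[b ord0]%:P) (b ord0).
    by rewrite /root !hornerE subrr.
  by exists g; rewrite -gE addrC subrK.
have [g gE] := boolp.choice fE.
pose N : 'M[B]_m.+1 := \matrix_(i, j)
  (if unlift ord0 j is Some j' then (g i).[b j] else (f i).[b ord0]).
pose U : 'M[B]_m.+1 := \matrix_(i, j)
  (if i == ord0 then 1 else (i == j)%:R * (b j - b ord0)).
have -> : \matrix_(i, j) (f i).[b j] = N *m U.
  apply/matrixP=> i j; rewrite !mxE big_ord_recl !mxE unlift_none eqxx mulr1.
  case: (unliftP ord0 j) => [j'|] ->.
    rewrite (bigD1 j') //= big1 => [|l nlj]; last first.
      by rewrite !mxE /= (inj_eq (@lift_inj _ _)) (negbTE nlj) mul0r mulr0.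
    rewrite !mxE liftK /= eqxx mul1r addr0.
    by rewrite {1}(gE i) !hornerE.
  rewrite big1 ?addr0 // => l _.
  by rewrite !mxE /= mul0r mulr0.
rewrite det_mulmx.
have -> : \det U = \prod_(j < m) (b (lift ord0 j) - b ord0).
  rewrite -det_tr det_trig; last first.
    apply/is_trig_mxP => i j lij; rewrite !mxE.
    have -> : (j == ord0) = false by case: j lij => -[].
    have -> : (j == i) = false by apply/eqP => ji; rewrite ji ltnn in lij.
    by rewrite mul0r.
  rewrite big_ord_recl !mxE eqxx mul1r; apply: eq_bigr => j _.
  by rewrite !mxE eqxx mul1r.
have cofE i : exists s, cofactor N i ord0 = s *
    \prod_(j < m) \prod_(l < m | (j < l)%N) (b (lift ord0 j) - b (lift ord0 l)).
  have [s sE] := IHm (fun j => b (lift ord0 j)) (fun j => g (lift i j)).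
  exists ((-1) ^+ (i + 0) * s); rewrite /cofactor -mulrA sE; congr (_ * \det _).
  by apply/matrixP=> j l; rewrite !mxE liftK.
have [s sE] := boolp.choice cofE.
exists ((\sum_i N i ord0 * s i) * (-1) ^+ m).
rewrite (expand_det_col _ ord0) big_ord_recl.
have -> : \prod_(j < m.+1 | (@ord0 m < j)%N) (b ord0 - b j)
          = (-1) ^+ m * \prod_(j < m) (b (lift ord0 j) - b ord0).
  rewrite big_mkcond big_ord_recl /= mul1r.
  rewrite -[in (-1) ^+ m](card_ord m) -prodrN.
  by apply: eq_bigr => j _; rewrite opprB.
have -> : \prod_(i < m) \prod_(j < m.+1 | (lift ord0 i < j)%N)
            (b (lift ord0 i) - b j)
          = \prod_(j < m) \prod_(l < m | (j < l)%N)
              (b (lift ord0 j) - b (lift ord0 l)).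
  apply: eq_bigr => i _; rewrite big_mkcond big_ord_recl /= mul1r.
  by rewrite [RHS]big_mkcond /=; apply: eq_bigr => j _; rewrite /bump /= ltnS.
under [X in _ = X * _]eq_bigr => i _ do rewrite sE mulrA.
rewrite -mulr_suml -!mulrA; congr (_ * _).
by rewrite mulrA -exprMn mulrNN mulr1 expr1n mul1r mulrC.
Qed.

Variables (L : comNzRingType) (y : nat -> L).

Definition fpow (x : {mpoly L[k]}) (m : nat) : {mpoly L[k]} :=
  \prod_(1 <= i < m.+1) (x - (y i)%:MP).

(* [i] and [j] count from 0, so lambda_i + k - i reads la i + (k - i.+1). *)
Definition alternant (la : 'I_k -> nat) : 'M[{mpoly L[k]}]_k :=
  \matrix_(i, j) fpow 'X_j (la i + (k - i.+1)).

Definition vandermonde : {mpoly L[k]} :=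
  \prod_(i < k) \prod_(j < k | (i < j)%N) ('X_i - 'X_j).

Lemma fschur_exists (la : 'I_k -> nat) :
  exists s, s * vandermonde == \det (alternant la).
Proof.
have [s sE] := alternant_dvd (fun j : 'I_k => 'X_j : {mpoly L[k]})
  (fun i => \prod_(1 <= l < (la i + (k - i.+1)).+1) ('X - (y l)%:MP%:P)).
exists s; rewrite [X in X == _]sE; apply/eqP; congr (\det _).
apply/matrixP=> i j; rewrite !mxE horner_prod /fpow.
by apply: eq_bigr => l _; rewrite !hornerE.
Qed.

(* The quotient of the alternant by the Vandermonde product; it is unique
   because the latter is not a zero divisor (vandermonde_lreg). *)
Definition fschur (la : 'I_k -> nat) : {mpoly L[k]} :=
  xchoose (fschur_exists la).

Lemma fschurE (la : 'I_k -> nat) :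
  fschur la * vandermonde = \det (alternant la).
Proof. exact/eqP/(xchooseP (fschur_exists la)). Qed.

Lemma vandermonde_lreg : GRing.lreg vandermonde.
Proof.
have lregX (i j : 'I_k) : i != j -> GRing.lreg ('X_i - 'X_j : {mpoly L[k]}).
  move=> nij; have nU : (U_(i) != U_(j))%MM.
    by apply: contra nij => /eqP/(congr1 (fun m : 'X_{1..k} => m j));
       rewrite !mnm1E eqxx; case: (i =P j).
  have leadE : mlead ('X_i - 'X_j : {mpoly L[k]}) = (U_(i) `|` U_(j))%MM%O.
    by rewrite mleadD mleadN !mleadXm.
  apply: lreg_mleadc; rewrite leadE.
  have [_|_] := leP U_(i)%MM U_(j)%MM.
    rewrite mcoeffB !mcoeffX eqxx (negbTE nU) sub0r.
    by apply: lregN; apply: lreg1.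
  rewrite mcoeffB !mcoeffX eqxx.
  by rewrite eq_sym (negbTE nU) subr0; apply: lreg1.
have lregP (I : Type) (r : seq I) (P : pred I) (F : I -> {mpoly L[k]}) :
    (forall i, P i -> GRing.lreg (F i)) -> GRing.lreg (\prod_(i <- r | P i) F i).
  by move=> FP; elim/big_ind: _ => //; [apply: lreg1 | apply: lregM].
rewrite /vandermonde; apply: (lregP) => i _; apply: (lregP) => j ij.
apply: lregX.
by apply: contraL ij => /eqP->; rewrite ltnn.
Qed.

Lemma msym_alternant (s : 'S_k) la :
  msym s (\det (alternant la)) = (-1) ^+ s * \det (alternant la).
Proof.
rewrite -det_map_mx.
have -> : map_mx (msym s) (alternant la) = col_perm s (alternant la).
  apply/matrixP=> i j; rewrite !mxE rmorph_prod; apply: eq_bigr => l _.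
  rewrite rmorphB /= /msym mmapC; congr (_ - _).
  by rewrite mmapX mmap1U.
rewrite col_permE det_mulmx det_perm odd_permV mulrC //.
Qed.

Lemma msym_vandermonde (s : 'S_k) :
  msym s vandermonde = (-1) ^+ s * vandermonde.
Proof.
have VE : vandermonde = (\prod_(i < k) \prod_(j < k | (i < j)%N) -1)
    * \det (Vandermonde k (\row_j ('X_j : {mpoly L[k]}))).
  rewrite det_Vandermonde -big_split /=; apply: eq_bigr => i _.
  rewrite -big_split /=; apply: eq_bigr => j _.
  by rewrite !mxE mulN1r opprB.
rewrite {1}VE rmorphM rmorph_prod /=.
under eq_bigr => i _ do
  (rewrite rmorph_prod /=; under eq_bigr => j _ do rewrite rmorphN1).
rewrite VE mulrCA; congr (_ * _).
rewrite -det_map_mx.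
set V := Vandermonde _ _.
have -> : map_mx (msym s) V = col_perm s V.
  apply/matrixP=> i j; rewrite !mxE rmorphXn /=; congr (_ ^+ _).
  by rewrite /msym mmapX mmap1U.
by rewrite col_permE det_mulmx det_perm odd_permV mulrC.
Qed.

Lemma fschur_sym (la : 'I_k -> nat) : fschur la \is symmetric.
Proof.
apply/issymP => s; apply: vandermonde_lreg; rewrite ![vandermonde * _]mulrC.
have : msym s (fschur la * vandermonde) = (-1) ^+ s * (fschur la * vandermonde).
  by rewrite fschurE msym_alternant.
rewrite msymM msym_vandermonde mulrCA => /(congr1 ( *%R ((-1) ^+ s))).
by rewrite !mulrA -!signr_addb addbb !mul1r.
Qed.

Definition fschur_symp (la : 'I_k -> nat) : sympoly k L :=
  SymPoly (fschur_sym la).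

Definition hcomplete (r : nat) : sympoly k L :=
  fschur_symp (fun i => if i == 0%N :> nat then r else 0%N).

End FactorialSchur.

Section QuantumCohomology.
Variables (n k : nat) (L : comNzRingType) (y : nat -> L) (q : L).

(* h_{n-k+1}, ..., h_{n-1}, h_n + (-1)^k q *)
Definition qH_relations : seq (sympoly k L) :=
  [seq hcomplete k y r + ((-1) ^+ k * q * (r == n)%:R)%:A
     | r <- iota (n - k).+1 k].

Definition qH : Type := gen_quot qH_relations.

HB.instance Definition _ := GRing.ComPzRing.on qH.
HB.instance Definition _ := GRing.Lmodule.on qH.

Definition qH_class : sympoly k L -> qH := @gen_class L _ qH_relations.

End QuantumCohomology.

Section ExteriorAlgebra.
Variables (n : nat) (L : comNzRingType).

(* The exterior algebra of L^n on its standard basis: x A is the coefficient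
   of v_{a_1} /\ ... /\ v_{a_d}, where a_1 < ... < a_d are the elements of
   A. *)
Definition ext := {ffun {set 'I_n} -> L^o}.

Definition ext1 : ext := [ffun A : {set 'I_n} => (A == set0)%:R].

(* v /\ x, from v_i /\ v_B = (-1)^#{j in B | j < i} v_{i |: B} if i is not in
   B, and 0 otherwise. *)
Definition wedge (v : 'cV[L]_n) (x : ext) : ext :=
  [ffun A : {set 'I_n} =>
     \sum_(i in A) (-1) ^+ #|[set j in A | (j < i)%N]| * v i 0 * x (A :\ i)].

Definition homogeneous (d : nat) : {pred ext} :=
  fun x => [forall A : {set 'I_n}, (x A != 0) ==> (#|A| == d)].

Lemma homogeneousP d (x : ext) :
  reflect (forall A : {set 'I_n}, #|A| != d -> x A = 0) (homogeneous d x).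
Proof.
apply: (iffP forallP) => xd A; last first.
  by apply/implyP; apply: contraR => /xd ->.
by move/implyP: (xd A) => xA; apply: contraNeq => /xA.
Qed.

Lemma homogeneous_submod_closed d : submod_closed (homogeneous d).
Proof.
split; first by apply/homogeneousP => A _; rewrite ffunE.
move=> a x z /homogeneousP xd /homogeneousP zd; apply/homogeneousP => A Ad.
by rewrite !ffunE xd // zd // scaler0 addr0.
Qed.

HB.instance Definition _ d :=
  GRing.isSubmodClosed.Build L ext (homogeneous d)
    (homogeneous_submod_closed d).

Record extpow (d : nat) : predArgType := ExtPow {
  extpow_val :> ext;
  _ : extpow_val \in homogeneous d
}.

HB.instance Definition _ d := [isSub for @extpow_val d].
HB.instance Definition _ d := [Choice of extpow d by <:].
HB.instance Definition _ d := [SubChoice_isSubLmodule of extpow d by <:].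

Lemma foldr_wedge_homogeneous (s : seq 'cV[L]_n) :
  foldr wedge ext1 s \in homogeneous (size s).
Proof.
elim: s => [|v s IHs] /=; apply/homogeneousP => A Ad; rewrite ffunE.
  by rewrite -cards_eq0 (negbTE Ad).
rewrite big1 // => i iA; move/homogeneousP: IHs => -> ; first by rewrite mulr0.
by apply: contra Ad; rewrite (cardsD1 i A) iA add1n eqSS.
Qed.

Lemma wedges_subproof k (v : 'I_k -> 'cV[L]_n) :
  foldr wedge ext1 [seq v j | j <- enum 'I_k] \in homogeneous k.
Proof.
have := foldr_wedge_homogeneous [seq v j | j <- enum 'I_k].
by rewrite size_map size_enum_ord.
Qed.

(* (v_1 /\ _) o ... o (v_k /\ _) applied to 1 *)
Definition wedges k (v : 'I_k -> 'cV[L]_n) : extpow k :=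
  ExtPow (wedges_subproof v).


End ExteriorAlgebra.

Section TensorPower.
Variables (n k : nat) (L : comNzRingType).

(* The k-th tensor power of L^n: t f is the coefficient of
   v_{f 1} (x) ... (x) v_{f k}. *)
Definition tensor := {ffun {ffun 'I_k -> 'I_n} -> L^o}.

Definition tensor_basis (f : {ffun 'I_k -> 'I_n}) : tensor :=
  [ffun g => (g == f)%:R].

(* The matrix M acting on the i-th factor. *)
Definition tensor_act (M : 'M[L]_n) (i : 'I_k) (t : tensor) : tensor :=
  [ffun f : {ffun 'I_k -> 'I_n} =>
     \sum_a M (f i) a * t [ffun j => if j == i then a else f j]].

(* p(M_1, ..., M_k) where M_i is M acting on the i-th factor. *)
Definition tensor_poly (M : 'M[L]_n) (p : {mpoly L[k]}) (t : tensor) : tensor :=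
  \sum_(m <- msupp p)
     p@_m *: foldr (fun i => iter (m i) (tensor_act M i)) t (enum 'I_k).

Definition ext_basis (f : {ffun 'I_k -> 'I_n}) : extpow n L k :=
  wedges (fun j => delta_mx (f j) 0).

(* The projection of the tensor power onto the exterior power. *)
Definition tensor_ext (t : tensor) : extpow n L k :=
  \sum_f (t f : L) *: ext_basis f.

End TensorPower.

Section Grassmannian.
Variables (n k : nat) (hk : (k <= n)%N).

Definition grassmannian (w : 'S_n) : bool :=
  [forall i : 'I_n, forall j : 'I_n,
     ((i < j) && ((j < k) || (k <= i)))%N ==> (w i < w j)%N].

(* [w_1, ..., w_k], as values in 'I_n, hence shifted by one. *)
Definition gfun (w : 'S_n) : {ffun 'I_k -> 'I_n} :=
  [ffun j => w (widen_ord hk j)].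

(* Positions and values are both shifted by one, so w_j - j is unchanged. *)
Definition gpart (w : 'S_n) (r : 'I_k) : nat :=
  (gfun w (rev_ord r) - rev_ord r)%N.

Variable L : comNzRingType.

Definition ket (w : 'S_n) : extpow n L k := ext_basis L (gfun w).

(* The coordinate of x along |w>. *)
Definition coord (w : 'S_n) (x : extpow n L k) : L :=
  extpow_val x [set gfun w j | j : 'I_k].

End Grassmannian.

Section Tableaux.
Variables (n k : nat).

(* Partitions with at most k parts; la r is the (r+1)-st part. *)
Definition is_partition (la : 'I_k -> nat) : bool :=
  [forall r : 'I_k, forall s : 'I_k, (r <= s)%N ==> (la s <= la r)%N].

Definition fits (a b : nat) (la : 'I_k -> nat) : bool :=
  [forall r : 'I_k, (la r <= b)%N && ((a <= r)%N ==> (la r == 0%N))].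

(* The box in row r and column c (both from 0) is in nu / mu iff
   mu r <= c < nu r. *)
Definition horizontal_strip (mu nu : 'I_k -> nat) : bool :=
  [forall c : 'I_n, #|[set r : 'I_k | (mu r <= c < nu r)%N]| <= 1]%N.

(* The partitions lambda^(0), ..., lambda^(k), a priori arbitrary. *)
Definition part_chain := {ffun 'I_k.+1 -> {ffun 'I_k -> 'I_n.+1}}.

Definition part (T : part_chain) (i : 'I_k.+1) (r : 'I_k) : nat := T i r.

Definition part_pred (T : part_chain) (i : 'I_k) : 'I_k -> nat :=
  part T (widen_ord (leqnSn k) i).
Definition part_succ (T : part_chain) (i : 'I_k) : 'I_k -> nat :=
  part T (lift ord0 i).

Definition ssyt (la : 'I_k -> nat) (T : part_chain) : bool :=
  [&& [forall r, part T ord0 r == 0%N],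
      [forall r, part T ord_max r == la r],
      [forall i, is_partition (part T i) && fits i (n - i)%N (part T i)] &
      [forall i, [forall r, part_pred T i r <= part_succ T i r]%N
                 && horizontal_strip (part_pred T i) (part_succ T i)]].

End Tableaux.

Section Products.
Variables (n k : nat) (hk : (k <= n)%N).
Variables (L : comNzRingType) (y : nat -> L) (q : L).

Definition zq : L := (-1) ^+ k.-1 * q.

Definition Xq : 'M[L]_n :=
  \matrix_(i, j) (zq *+ ((i == 0%N :> nat) && (j.+1 == n))
                  + (i == j.+1 :> nat)%:R + y i.+1 *+ (i == j)).

(* The span of the psi*_i is identified with L^n, psi*_i being v_i /\ _;
   here i is counted from 1 and psi*_{n+1} = z psi*_1. *)
Definition psi (i : nat) : 'cV[L]_n :=
  if i == n.+1 then \col_a (zq *+ (a == 0%N :> nat))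
  else \col_a (a.+1 == i)%:R.

(* t_j as a matrix: the column of index b is t_j . psi*_{b+1}. *)
Definition transl (j : nat) : 'M[L]_n :=
  \matrix_(a, b) (psi b.+2 + (y b.+1 - y j) *: psi b.+1) a 0.

(* The product of the t_{m + c(box)} over the boxes of nu / mu. *)
Definition transl_strip (m : nat) (mu nu : 'I_k -> nat) : 'M[L]_n :=
  \big[mulmx/1%:M]_(r < k) \big[mulmx/1%:M]_(mu r <= c < nu r)
     transl (m + c - r)%N.

(* rho_{j+1} = la^(k-j) / la^(k-j-1) and k + 1 - (j+1) = k - j. *)
Definition ostar_basis (u w : 'S_n) : extpow n L k :=
  \sum_(T : part_chain n k | ssyt (gpart hk u) T)
     wedges (fun j : 'I_k =>
       transl_strip (k - j)%N (part_pred T (rev_ord j)) (part_succ T (rev_ord j))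
         *m psi (gfun hk w j).+1).

Definition ostar (x x' : extpow n L k) : extpow n L k :=
  \sum_(u | grassmannian k u) \sum_(w | grassmannian k w)
     (coord hk u x * coord hk w x') *: ostar_basis u w.

(* The operator on the exterior power induced by p(X_1^q, ..., X_k^q), p
   symmetric, computed on the lift of |w> to the tensor power. *)
Definition ext_poly (p : {mpoly L[k]}) (x : extpow n L k) : extpow n L k :=
  \sum_(w | grassmannian k w)
     coord hk w x *: tensor_ext (tensor_poly Xq p (tensor_basis L (gfun hk w))).

Definition qstar (x x' : extpow n L k) : extpow n L k :=
  \sum_(u | grassmannian k u)
     coord hk u x *: ext_poly (fschur y (gpart hk u)) x'.

Definition schubert (w : 'S_n) : qH n k y q :=
  @qH_class n k L y q (fschur_symp y (gpart hk w)).

End Products.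

Section Kets.
Variables (n k : nat) (hk : (k <= n)%N) (L : comNzRingType).

Lemma foldr_wedge_delta (s : seq 'I_n) : sorted (fun i j : 'I_n => i < j)%N s ->
  foldr (@wedge n L) (ext1 n L) [seq delta_mx i 0 | i <- s]
  = [ffun A : {set 'I_n} => (A == [set i in s])%:R].
Proof.
have ltn_ord_trans : transitive (fun i j : 'I_n => i < j)%N.
  by move=> ? ? ?; apply: ltn_trans.
elim: s => [|i s IHs] /=.
  by move=> _; apply/ffunP => A; rewrite !ffunE.
rewrite path_sortedE // => /andP[/allP lis /IHs ->].
have nis : i \notin s by apply/negP => /lis; rewrite ltnn.
apply/ffunP => A; rewrite !ffunE.
have -> : (A == [set j in i :: s]) = (i \in A) && (A :\ i == [set j in s]).
  apply/eqP/andP => [->|[iA /eqP AE]].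
    rewrite inE mem_head; split=> //; apply/eqP/setP => j; rewrite !inE.
    by case: eqP => //= ->; rewrite (negbTE nis).
  apply/setP => j; move/setP: AE => /(_ j); rewrite !inE.
  by case: eqP => //= ->.
case: (boolP (i \in A)) => iA; last first.
  rewrite big1 // => j jA; rewrite !mxE andbT.
  have /negbTE -> : j != i by apply: contraNneq iA => <-.
  by rewrite mulr0 mul0r.
rewrite (bigD1 i) //= big1 ?addr0 => [|j /andP[_ /negbTE nji]]; last first.
  by rewrite !mxE nji mulr0 mul0r.
rewrite !mxE !eqxx mulr1 ffunE; case: eqP => [AE|]; last by rewrite mulr0.
suff -> : [set j in A | (j < i)%N] = set0 by rewrite cards0 expr0 mulr1.
apply/setP => j; rewrite !inE; apply/negP => /andP[jA ji].
have : j \in A :\ i by rewrite !inE jA andbT; apply: contraL ji => /eqP->; rewrite ltnn.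
by rewrite AE inE => /lis; rewrite ltnNge ltnW.
Qed.

Lemma sorted_enum_ord m : sorted (fun i j : 'I_m => i < j)%N (enum 'I_m).
Proof.
by have := iota_ltn_sorted 0 m; rewrite -val_enum_ord sorted_map.
Qed.

Lemma gfun_lt w (i j : 'I_k) :
  grassmannian k w -> (i < j)%N -> (gfun hk w i < gfun hk w j)%N.
Proof.
move=> /forallP/(_ (widen_ord hk i))/forallP/(_ (widen_ord hk j))/implyP wP ij.
by rewrite !ffunE; apply: wP; rewrite /= ij ltn_ord.
Qed.

Lemma gfun_sorted w : grassmannian k w ->
  sorted (fun i j : 'I_n => i < j)%N [seq gfun hk w j | j <- enum 'I_k].
Proof.
move=> gw; rewrite sorted_map; apply: sub_sorted (sorted_enum_ord k) => i j.
exact: gfun_lt.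
Qed.

Lemma gset_seq w :
  [set i in [seq gfun hk w j | j <- enum 'I_k]] = [set gfun hk w j | j : 'I_k].
Proof.
apply/setP => i; rewrite inE; apply/mapP/imsetP => [[j _ ->]|[j _ ->]].
  by exists j.
by exists j => //; rewrite mem_enum.
Qed.

Lemma ketE w A : grassmannian k w ->
  extpow_val (ket hk L w) A = (A == [set gfun hk w j | j : 'I_k])%:R.
Proof.
move=> gw; rewrite /= (map_comp (fun i => delta_mx i 0) (gfun hk w)).
by rewrite foldr_wedge_delta ?gfun_sorted // ffunE gset_seq.
Qed.

Lemma gset_inj : {in grassmannian k &,
  injective (fun w : 'S_n => [set gfun hk w j | j : 'I_k])}.
Proof.
have lt_trans : transitive (fun i j : 'I_n => i < j)%N.
  by move=> ? ? ?; apply: ltn_trans.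
have lt_irr : irreflexive (fun i j : 'I_n => i < j)%N by move=> ?; apply: ltnn.
move=> w w' gw gw' ww'.
have headE i : (i < k)%N ->
    forall hi : (i < n)%N, w (Ordinal hi) = w' (Ordinal hi).
  move=> ik hi.
  have : [seq gfun hk w j | j <- enum 'I_k] = [seq gfun hk w' j | j <- enum 'I_k].
    apply: irr_sorted_eq lt_trans lt_irr _ _ _ _ _; try exact: gfun_sorted.
    by move=> j; move/setP: ww' => /(_ j); rewrite -!gset_seq !inE.
  move/eq_in_map => /(_ (Ordinal ik)); rewrite mem_enum => /(_ isT).
  by rewrite !ffunE; have -> : widen_ord hk (Ordinal ik) = Ordinal hi
    by apply/val_inj.
have tail_sorted (v : 'S_n) : grassmannian k v -> sorted (fun i j : 'I_n => i < j)%N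
    [seq v i | i : 'I_n <- enum 'I_n & (k <= i)%N].
  move=> gv; rewrite sorted_map.
  have : sorted (fun i j : 'I_n => i < j)%N [seq i : 'I_n <- enum 'I_n | (k <= i)%N].
    by apply: sorted_filter => //; apply: sorted_enum_ord.
  apply: (@sub_in_sorted _ (fun i : 'I_n => (k <= i)%N)); last exact: filter_all.
  move=> i j ki kj ij.
  move/forallP: gv => /(_ i)/forallP/(_ j)/implyP; apply.
  by rewrite ij [(k <= i)%N]ki orbT.
have tail_mem (v : 'S_n) x : (x \in [seq v i | i : 'I_n <- enum 'I_n & (k <= i)%N])
    = (x \notin [set gfun hk v j | j : 'I_k]).
  apply/mapP/idP => [[i]|xv].
    rewrite mem_filter => /andP[ki _] ->; apply/imsetP => -[j _].
    rewrite ffunE => /perm_inj ij; move: ki; rewrite ij /=.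
    by rewrite leqNgt ltn_ord.
  exists ((v^-1)%g x); last by rewrite permKV.
  rewrite mem_filter mem_enum andbT leqNgt; apply: contra xv => ltk.
  apply/imsetP; exists (Ordinal ltk) => //; rewrite ffunE.
  by rewrite (_ : widen_ord _ _ = (v^-1)%g x) ?permKV //; apply/val_inj.
apply/permP => i; have [ik|ki] := ltnP i k.
  by case: i ik => i hi /= /headE; apply.
have : [seq w i | i : 'I_n <- enum 'I_n & (k <= i)%N]
     = [seq w' i | i : 'I_n <- enum 'I_n & (k <= i)%N].
  apply: irr_sorted_eq lt_trans lt_irr _ _ _ _ _; try exact: tail_sorted.
  by move=> j; rewrite !tail_mem ww'.
by move/eq_in_map; apply; rewrite mem_filter ki mem_enum.
Qed.

Lemma coord_ket u w : grassmannian k u -> grassmannian k w ->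
  coord hk u (ket hk L w) = (u == w)%:R.
Proof.
move=> gu gw; rewrite /coord ketE //; congr (_%:R).
by congr nat_of_bool; apply/eqP/eqP => [/gset_inj->|->].
Qed.

Variables (y : nat -> L) (q : L).

Lemma ostar_ket u w : grassmannian k u -> grassmannian k w ->
  ostar hk y q (ket hk L u) (ket hk L w) = ostar_basis hk y q u w.
Proof.
move=> gu gw; rewrite /ostar (bigD1 u) //= [X in _ + X]big1.
  rewrite addr0 (bigD1 w) //= [X in _ + X]big1.
    by rewrite !coord_ket // !eqxx mulr1 scale1r addr0.
  move=> w' /andP[gw' /negbTE nw].
  by rewrite [X in _ * X]coord_ket // nw mulr0 scale0r.
move=> u' /andP[gu' /negbTE nu]; rewrite big1 // => w' _.
by rewrite coord_ket // nu mul0r scale0r.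
Qed.

Lemma qstar_ket u w : grassmannian k u -> grassmannian k w ->
  qstar hk y q (ket hk L u) (ket hk L w)
  = tensor_ext (tensor_poly (Xq n k y q) (fschur y (gpart hk u))
                  (tensor_basis L (gfun hk w))).
Proof.
move=> gu gw; rewrite /qstar (bigD1 u) //= [X in _ + X]big1.
  rewrite addr0 coord_ket // eqxx scale1r /ext_poly.
  rewrite (bigD1 w) //= [X in _ + X]big1.
    by rewrite coord_ket // eqxx scale1r addr0.
  by move=> w' /andP[gw' /negbTE nw]; rewrite coord_ket // nw scale0r.
by move=> u' /andP[gu' /negbTE nu]; rewrite coord_ket // nu scale0r.
Qed.

End Kets.

(* Main.v *)
From HB Require Import structures.
From mathcomp Require Import all_boot all_order all_fingroup all_algebra.
From mathcomp Require Import mpoly ring zify.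
Require Import Defs.

Set Implicit Arguments.
Unset Strict Implicit.
Unset Printing Implicit Defensive.

Import Order.TTheory GRing.Theory.
Local Open Scope ring_scope.

(** Write L for the coefficient ring, X for the matrix [Xq],
    e_m(x) = (x - y_1)...(x - y_m), z = (-1)^(k-1) q and P = e_n - z.  Since X
    sends v_i to v_{i+1} + y_i v_i, one has e_m(X) v_1 = v_{m+1} for m < n and
    e_n(X) v_1 = z v_1, so P(X) v_1 = 0 (lemmas [fpoly_v1] and [qchar_v1]).

    The proof compares two L-linear maps defined on L[x_1, ..., x_k]:
    - T (below [eval_v1]) sends f to the image in the exterior power of
      f(X_1, ..., X_k) (v_1 (x) ... (x) v_1);
    - D (below [divsym]) sends f to Alt(f) / prod_{i<j} (x_j - x_i), a symmetric
      polynomial; D is linear over symmetric polynomials.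
    On E_w = prod_j e_{w_j - 1}(x_j), with w Grassmannian, T takes the value |w>
    and D the value s_{lambda(w)}.  Both are antisymmetric under permutation of
    the variables.  T kills every multiple of P(x_j).  D maps such multiples into
    the ideal I of quantum relations ([divsym_qchar_ideal]): division by
    prod_i (x - x_i) gives P(x_j) = sum_i F_i x_j^i with F_i symmetric, and the
    relations are D(P(x_k) x_k^s e_0(x_1)...e_{k-2}(x_{k-1})), 0 <= s < k, which
    express through the F_i by a unitriangular system, so all F_i lie in I.
    As every polynomial reduces modulo the P(x_j) to a combination of products
    of e_a with a < n, the linear map Phi with Phi|w> = sigma_w satisfies
    Phi(T f) = [D f] for all f ([compatible_all]).

    This gives the ring statement.  By definition of the operators s_lambda(X),
    |u> * |w> = T(s_{lambda(u)} E_w), hence Phi(|u> * |w>) = [D(s_{lambda(u)} E_w)]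
    = sigma_u sigma_w.  For bijectivity, T(Alt f) = k! T f, and L has no k!
    torsion, so T f depends on D f only: T f = U(D f) with U(p) = T(p E_id).  Then
    U vanishes on I and induces the inverse of Phi.  Associativity and
    commutativity are transported along Phi.

    The identity of the two products is the tableau formula
    s_lambda = sum_T prod_boxes (x_j - y_{k+1-j+c}) ([fschur_tableaux]) evaluated
    at the X_i: t_j acts as X - y_j, and a product of polynomials in separate
    variables acts on a wedge factor by factor ([wedge_eval_prod]).  The formula
    follows by iterating the branching rule [altdet_branch], which removes one
    variable from the numerator determinant by eliminating its first column. *)

(** * Branching rule for factorial alternants *)

Section Branching.
Variable B : comNzRingType.

Lemma det_sum_rows (X : finType) i (c : 'I_i -> X -> B)
    (f : 'I_i -> X -> 'I_i -> B) :
  \det (\matrix_(r, j) \sum_a c r a * f r a j) =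
  \sum_(g : {ffun 'I_i -> X})
     (\prod_r c r (g r)) * \det (\matrix_(r, j) f r (g r) j).
Proof.
rewrite /determinant.
under eq_bigr => s _.
  under eq_bigr => r _ do rewrite mxE.
  rewrite bigA_distr_bigA big_distrr /=.
  over.
rewrite exchange_big /=; apply: eq_bigr => g _.
rewrite big_distrr /=; apply: eq_bigr => s _.
rewrite big_split /= mulrCA; congr (_ * (_ * _)).
by apply: eq_bigr => r _; rewrite mxE.
Qed.

Variable y : nat -> B.

Definition ffact (x : B) (m : nat) : B := \prod_(1 <= p < m.+1) (x - y p).

Lemma ffactS x m : ffact x m.+1 = ffact x m * (x - y m.+1).
Proof. by rewrite /ffact big_nat_recr. Qed.

(** Consecutive terms of the sum over m from l' to l - 1 cancel, because
    x - t = (x - y_{m+1}) - (t - y_{m+1}). *)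
Lemma ffact_telescope x t (l' l : nat) : (l' <= l)%N ->
  ffact x l - (\prod_(l'.+1 <= p < l.+1) (t - y p)) * ffact x l' =
  (x - t) * \sum_(l' <= m < l) (\prod_(m.+2 <= p < l.+1) (t - y p)) * ffact x m.
Proof.
move=> /subnKC <-; elim: (l - l')%N => [|d IHd].
  by rewrite addn0 !big_geq // mul1r mulr0 subrr.
rewrite addnS ffactS.
rewrite [in RHS]big_nat_recr /=; last by rewrite leq_addr.
rewrite [X in _ = _ * (_ + X * _)]big_geq // mul1r.
have -> : \sum_(l' <= m < l' + d)
    \prod_(m.+2 <= p < (l' + d).+2) (t - y p) * ffact x m =
    (t - y (l' + d).+1) * \sum_(l' <= m < l' + d)
      \prod_(m.+2 <= p < (l' + d).+1) (t - y p) * ffact x m.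
  rewrite big_distrr /=; apply: eq_big_nat => m /andP[_ ml].
  by rewrite big_nat_recr /= ?ltnS // mulrAC mulrC.
rewrite big_nat_recr /= ?ltnS ?leq_addr //.
move: IHd; set S := (\sum_(_ <= m < _) _); set A := \prod_(_ <= p < _) _.
move: S A (ffact x _) (ffact x l') (y _) => S A e e' yy IHd.
have -> : (x - t) * ((t - yy) * S + e) = (t - yy) * ((x - t) * S) + (x - t) * e.
  by ring.
by rewrite -IHd; ring.
Qed.

(** Numerator of the bialternant formula, with exponents and variables indexed
    by [nat] so that a variable can be removed without changing types. *)
Definition altdet (i : nat) (l : nat -> nat) (b : nat -> B) : B :=
  \det (\matrix_(r < i, j < i) ffact (b j) (l r)).

(** Subtracting from each row the multiple of the next one that cancels its
    entry in the column of [b 0] leaves a single entry there.  By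
    [ffact_telescope] the entries of the remaining minor in the column of
    [b j.+1] are then divisible by [b j.+1 - b 0]. *)
Lemma altdet_eliminate i l b : (forall r, (r < i)%N -> (l r.+1 <= l r)%N) ->
  altdet i.+1 l b =
  \prod_(j < i) (b 0 - b j.+1) * (ffact (b 0) (l i) *
  \det (\matrix_(r < i, j < i) \sum_(l r.+1 <= m < l r)
     (\prod_(m.+2 <= p < (l r).+1) (b 0 - y p)) * ffact (b j.+1) m)).
Proof.
move=> ldec.
pose A r := \prod_((l r.+1).+1 <= p < (l r).+1) (b 0 - y p).
(* [U] is unitriangular and performs the row operations. *)
pose U : 'M[B]_i.+1 := \matrix_(r, s) ((s == r)%:R - (s == r.+1 :> nat)%:R * A r).
have detU : \det U = 1.
  rewrite -det_tr det_trig; last first.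
    apply/is_trig_mxP => r s rs; rewrite !mxE.
    rewrite (ltn_eqF (leqW rs)) mul0r subr0.
    by case: eqP rs => // ->; rewrite ltnn.
  rewrite big1 // => r _; rewrite !mxE eqxx.
  by rewrite (ltn_eqF (ltnSn _)) mul0r subr0.
rewrite /altdet; set M := \matrix_(_, _) _.
have -> : \det M = \det (U *m M) by rewrite det_mulmx detU mul1r.
have NE (r j : 'I_i.+1) : (U *m M) r j = if (r < i)%N then
    ffact (b j) (l r) - A r * ffact (b j) (l r.+1) else ffact (b j) (l r).
  rewrite mxE; under eq_bigr => s _ do rewrite !mxE mulrBl.
  rewrite sumrB (bigD1 r) //= eqxx mul1r big1 ?addr0; last first.
    by move=> s /negbTE ->; rewrite mul0r.
  case: ifP => ri; last first.
    rewrite big1 ?subr0 // => s _; rewrite (ltn_eqF _) ?mul0r //.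
    by rewrite (leq_trans (ltn_ord s)) // ltnS leqNgt ri.
  rewrite (bigD1 (Ordinal (ri : (r.+1 < i.+1)%N))) //= eqxx mul1r big1 ?addr0 //.
  by move=> s; rewrite -val_eqE /= => /negbTE ->; rewrite !mul0r.
rewrite (expand_det_col _ ord0) (bigD1 ord_max) //= big1 ?addr0; last first.
  move=> r rmax; rewrite NE.
  have ri : (r < i)%N by rewrite ltn_neqAle -ltnS ltn_ord andbT.
  have -> := ri; rewrite ffact_telescope ?ldec //=.
  by rewrite subrr !mul0r.
rewrite NE ltnn /= [RHS]mulrCA; congr (_ * _).
rewrite /cofactor addn0.
set S := \matrix_(_, _) _.
have -> : row' ord_max (col' ord0 (U *m M)) =
    S *m diag_mx (\row_j (b j.+1 - b 0)).
  apply/matrixP => r j; rewrite mul_mx_diag [LHS]mxE [LHS]mxE NE !mxE.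
  by rewrite !lift_max /= ltn_ord ffact_telescope ?ldec // mulrC.
rewrite det_mulmx det_diag mulrCA mulrC; congr (_ * _).
rewrite -[in (-1) ^+ _](card_ord i) -prodrN; apply: eq_bigr => j _.
by rewrite mxE opprB.
Qed.

Lemma prod_shift (F : nat -> B) a m d :
  \prod_((a + d).+2 <= p < (m.+1 + d).+1) F p = \prod_(a <= c < m) F (c + d.+2)%N.
Proof. by rewrite addSn -!addnS big_addn addnK. Qed.

(** The strictly decreasing exponents lambda + delta, which label the rows of a
    bialternant numerator. *)
Definition staircase i (nu : nat -> nat) r := (nu r + (i - r.+1))%N.

(** Expanding [altdet_eliminate] by multilinearity in the rows chooses in each
    row r an exponent between two consecutive exponents of nu; the choices are
    the partitions g interlacing nu, and the leftover factors are indexed by the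
    boxes of nu / g. *)
Lemma altdet_branch (N i : nat) (nu : nat -> nat) b :
  (forall r, (r < i)%N -> (nu r.+1 <= nu r <= N)%N) ->
  altdet i.+1 (staircase i.+1 nu) b =
  \prod_(j < i) (b 0 - b j.+1) *
  \sum_(g : {ffun 'I_i -> 'I_N.+1} | [forall r : 'I_i, (nu r.+1 <= g r <= nu r)%N])
     (\prod_(0 <= c < nu i) (b 0 - y (i.+1 + c - i)))
     * (\prod_(r < i) \prod_(g r <= c < nu r) (b 0 - y (i.+1 + c - r)))
     * \det (\matrix_(r < i, j < i) ffact (b j.+1) (g r + (i - r.+1))).
Proof.
move=> nuP; have iE r : (r < i)%N -> (i - r = (i - r.+1).+1)%N.
  by move=> ri; rewrite subnSK.
rewrite altdet_eliminate /staircase; last first.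
  by move=> r ri; have /andP[? _] := nuP r ri; rewrite leq_add ?leq_sub2l.
congr (_ * _).
have -> : ffact (b 0) (nu i + (i.+1 - i.+1)) =
    \prod_(0 <= c < nu i) (b 0 - y (i.+1 + c - i)).
  rewrite subnn addn0 /ffact big_add1 /=; apply: eq_bigr => c _.
  by rewrite addSn subSn ?leq_addr // addKn.
under [RHS]eq_bigr => g _ do rewrite -mulrA.
rewrite -big_distrr /=; congr (_ * _).
pose c (r : 'I_i) (a : 'I_N.+1) := if (nu r.+1 <= a <= nu r)%N then
  \prod_(a <= c < nu r) (b 0 - y (i.+1 + c - r)) else 0.
rewrite [RHS](_ : _ = \sum_(g : {ffun 'I_i -> 'I_N.+1}) (\prod_r c r (g r))
   * \det (\matrix_(r < i, j < i) ffact (b j.+1) (g r + (i - r.+1)))); last first.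
  rewrite big_mkcond; apply: eq_bigr => g _; case: ifP => [/forallP gP|].
    by congr (_ * _); apply: eq_bigr => r _; rewrite /c gP.
  move/negbT; rewrite negb_forall => /existsP[r /negbTE gr].
  by rewrite (bigD1 r) //= /c gr !mul0r.
rewrite -(det_sum_rows c
  (fun (r : 'I_i) (a : 'I_N.+1) (j : 'I_i) => ffact (b j.+1) (a + (i - r.+1)))).
congr (\det _); apply/matrixP => r j; rewrite !mxE.
have ri := ltn_ord r; have /andP[nur nuN] := nuP r ri.
rewrite !subSS [(i - r)%N]iE // -[in (nu r + _)%N]addSnnS.
rewrite big_addn addnK.
rewrite (eq_bigr (fun a : 'I_N.+1 => if (nu r.+1 <= a <= nu r)%N then
   \prod_(a <= c < nu r) (b 0 - y (i.+1 + c - r)) *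
   ffact (b j.+1) (a + (i - r.+1)) else 0)); last first.
  by move=> a _; rewrite /c; case: ifP; rewrite ?mul0r.
rewrite -big_mkcond /=.
rewrite big_geq_mkord (big_ord_widen_cond N.+1 (fun a => nu r.+1 <= a)%N
  (fun a => (\prod_((a + (i - r.+1)).+2 <= p < ((nu r).+1 + (i - r.+1)).+1)
     (b 0 - y p)) * ffact (b j.+1) (a + (i - r.+1)))) //.
apply: eq_big => [a|a /andP[_ anu]]; first by rewrite ltnS.
congr (_ * _).
rewrite prod_shift; apply: eq_bigr => e _; congr (_ - y _).
by rewrite -iE // -subSn ?(ltnW ri) // addnBA 1?addnC // ltnW // ltnW.
Qed.

End Branching.

(** * Tableau expansion of factorial Schur polynomials *)

(** Transfer-matrix principle: iterating a linear recursion sums the weights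
    of all paths from [x0].  Its paths will be the chains of partitions that
    encode tableaux. *)
Lemma path_sum (X : finType) (A : comNzRingType) (x0 : X)
    (E : nat -> X -> X -> A) (F : nat -> X -> A) :
  (forall x, F 0 x = (x == x0)%:R) ->
  (forall i x, F i.+1 x = \sum_x' E i x' x * F i x') ->
  forall m x, F m x =
    \sum_(T : {ffun 'I_m.+1 -> X} | (T ord0 == x0) && (T ord_max == x))
      \prod_(i < m) E i (T (widen_ord (leqnSn m) i)) (T (lift ord0 i)).
Proof.
move=> F0 FS; elim=> [|m IHm] x.
  rewrite F0 (eq_bigr (fun=> 1)) => [|T _]; last by rewrite big_ord0.
  have [->|nx] := eqVneq x x0.
    rewrite (big_pred1 [ffun=> x0]) // => T.
    rewrite (_ : ord_max = ord0) ?andbb; last exact/val_inj.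
    by apply/eqP/eqP => [T0|->]; [apply/ffunP => i; rewrite ord1 ffunE | rewrite ffunE].
  rewrite big_pred0 // => T; rewrite (_ : ord_max = ord0); last exact/val_inj.
  by apply/negP => /andP[/eqP-> /eqP xx]; rewrite xx eqxx in nx.
pose ext (T : {ffun 'I_m.+1 -> X}) : {ffun 'I_m.+2 -> X} :=
  [ffun i : 'I_m.+2 => if (i < m.+1)%N then T (inord i) else x].
pose res (T : {ffun 'I_m.+2 -> X}) : {ffun 'I_m.+1 -> X} :=
  [ffun i => T (widen_ord (leqnSn m.+1) i)].
have extK T : res (ext T) = T.
  apply/ffunP => i; rewrite !ffunE /= ltn_ord; congr (T _).
  by apply/val_inj; rewrite /= inordK.
rewrite FS (reindex_onto ext res) /=; last first.
  move=> T /andP[_ /eqP Tx]; apply/ffunP => i; rewrite !ffunE.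
  case: ltnP => im; first by congr (T _); apply/val_inj; rewrite /= inordK.
  rewrite -Tx; congr (T _); apply/val_inj => /=.
  by apply/eqP; rewrite eqn_leq im -ltnS ltn_ord.
rewrite (eq_bigl (fun T : {ffun 'I_m.+1 -> X} => T ord0 == x0)); last first.
  move=> T; rewrite extK eqxx andbT !ffunE /= ltnn eqxx andbT.
  by congr (T _ == _); apply/val_inj; rewrite /= inordK.
rewrite (partition_big (fun T : {ffun 'I_m.+1 -> X} => T ord_max) predT) //=.
apply: eq_bigr => x' _; rewrite IHm big_distrr /=.
apply: eq_bigr => T /andP[_ /eqP Tx'].
rewrite [RHS]big_ord_recr /= mulrC; congr (_ * _).
  apply: eq_bigr => i _; rewrite !ffunE /= /bump /= add1n.
  rewrite !ltnS (ltnW (ltn_ord i)) ltn_ord.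
  by congr (E i (T _) (T _)); apply/val_inj; rewrite /= inordK ?ltnS // ltnW.
rewrite !ffunE /= /bump /= add1n ltnn ltnSn -Tx'; congr (E m (T _) x).
by apply/val_inj; rewrite /= inordK.
Qed.

Section TableauFormula.
Variables (n k : nat) (L : comNzRingType) (y : nat -> L).

Local Notation X := {ffun 'I_k -> 'I_n.+1}.

Definition row_lengths (mu : X) (r : 'I_k) : nat := mu r.

(** Extension by zero rows, so that the row index can exceed the shape. *)
Definition nat_rows (mu : X) (r : nat) : nat :=
  if insub r is Some r' then mu r' else 0%N.

Lemma nat_rowsE (mu : X) (r : 'I_k) : nat_rows mu r = mu r.
Proof. by rewrite /nat_rows valK. Qed.

Definition nat_var (j : nat) : {mpoly L[k]} :=
  if insub j is Some j' then 'X_j' else 0.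

Lemma nat_varE (j : 'I_k) : nat_var j = 'X_j.
Proof. by rewrite /nat_var valK. Qed.

Definition rect_partition i (nu : X) : bool :=
  is_partition (row_lengths nu) && fits i (n - i) (row_lengths nu).

Definition strip_weight i (mu nu : X) : {mpoly L[k]} :=
  \prod_(r < k) \prod_(mu r <= c < nu r)
     (nat_var (k - i.+1) - (y (i.+1 + c - r))%:MP).

Definition strip_step i (mu nu : X) : bool :=
  rect_partition i.+1 nu &&
  ([forall r, (row_lengths mu r <= row_lengths nu r)%N] &&
   horizontal_strip n (row_lengths mu) (row_lengths nu)).

(** The tableau sum over the first i levels, as a recursion that adds one
    horizontal strip at a time; level i involves the last i variables. *)
Fixpoint tableau_sum (i : nat) (nu : X) : {mpoly L[k]} :=
  if i is i'.+1 then
    \sum_mu (if strip_step i' mu nu then strip_weight i' mu nu else 0)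
      * tableau_sum i' mu
  else (nu == [ffun=> ord0])%:R.

Lemma rect_partition_nat i nu : rect_partition i nu ->
  [/\ forall r, (nat_rows nu r.+1 <= nat_rows nu r)%N,
      forall r, (nat_rows nu r <= n - i)%N &
      forall r, (i <= r)%N -> nat_rows nu r = 0%N].
Proof.
move=> /andP[/forallP pnu /forallP fnu]; split=> r.
- rewrite /nat_rows; case: insubP => [s _ sr|//].
  case: insubP => [t _ tr|/negP[]]; last by apply: ltnW; rewrite -sr ltn_ord.
  have /forallP/(_ s)/implyP := pnu t; apply.
  by rewrite tr sr.
- by rewrite /nat_rows; case: insubP => [s _ _|//]; case/andP: (fnu s).
- rewrite /nat_rows; case: insubP => [s _ sr|//].
  by case/andP: (fnu s) => _ /implyP; rewrite sr => ir /ir /eqP.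
Qed.

(** A skew shape has two boxes in some column iff row r+1 of the outer shape
    overhangs row r of the inner one; hence horizontal strips are exactly
    interlacing pairs. *)
Lemma strip_stepP i mu nu : rect_partition i.+1 nu -> rect_partition i mu ->
  strip_step i mu nu = [forall r : 'I_k, (nat_rows nu r.+1 <= mu r <= nu r)%N].
Proof.
move=> vnu vmu; rewrite /strip_step vnu /=.
have [nud nun _] := rect_partition_nat vnu; have [mud mun _] := rect_partition_nat vmu.
have anti (la : nat -> nat) : (forall r, la r.+1 <= la r)%N ->
    forall r s, (r <= s)%N -> (la s <= la r)%N.
  move=> lad r s /subnKC <-; elim: (s - r)%N => [|d IHd]; first by rewrite addn0.
  by rewrite addnS (leq_trans (lad _)).
apply/andP/forallP => [[/forallP munu /forallP hs] r|il].
  rewrite munu andbT leqNgt; apply/negP => lt.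
  have cn : (mu r < n)%N.
    by rewrite (leq_trans lt) // (leq_trans (nun _)) // leq_subr.
  have rk : (r.+1 < k)%N.
    by move: lt; rewrite /nat_rows; case: insubP.
  (* Rows r and r+1 both have a box in column [mu r]. *)
  have := hs (Ordinal cn); rewrite leqNgt => /negP; apply.
  rewrite (cardsD1 r) (cardsD1 (Ordinal rk)) !inE /=.
  rewrite leqnn /= -nat_rowsE in lt *.
  have mu1 : (mu (Ordinal rk) <= nat_rows mu r)%N.
    by rewrite -(nat_rowsE mu (Ordinal rk)) /= mud.
  have -> : (nat_rows mu r < nu r)%N.
    by rewrite (leq_trans lt) // -(nat_rowsE nu r) nud.
  have -> : (nat_rows mu r < nu (Ordinal rk))%N.
    by rewrite -(nat_rowsE nu (Ordinal rk)).
  rewrite mu1 -val_eqE /= neq_ltn ltnSn orbT /=.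
  by rewrite addnA addn1.
split; first by apply/forallP => r; case/andP: (il r).
apply/forallP => c; rewrite leqNgt; apply/negP => /card_gt1P[r [s []]].
wlog rs : r s / (r < s)%N.
  move=> H rA sA nrs; have [||/val_inj ers] := ltngtP r s.
  - by move/H; apply.
  - by move/H; apply => //; rewrite eq_sym.
  - by rewrite ers eqxx in nrs.
rewrite !inE => /andP[c1 c2] /andP[c3 c4] _.
case/andP: (il r) => + _; rewrite leqNgt => /negP; apply.
rewrite (leq_ltn_trans c1) // (leq_trans c4) // -[row_lengths nu s]nat_rowsE.
exact: anti nud _ _ rs.
Qed.

Lemma rect_partition0 nu : rect_partition 0 nu = (nu == [ffun=> ord0]).
Proof.
apply/idP/eqP => [/rect_partition_nat[_ _ nu0]|->].
  apply/ffunP => r; apply/val_inj; rewrite ffunE.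
  by rewrite -[LHS]/(nat_of_ord (nu r)) -nat_rowsE nu0.
apply/andP; split.
  by apply/forallP => r; apply/forallP => s; rewrite /row_lengths !ffunE implybT.
by apply/forallP => r; rewrite /row_lengths ffunE.
Qed.

Definition vandermonde_tail i : {mpoly L[k]} :=
  \prod_(r < i) \prod_(s < i | (r < s)%N)
    (nat_var (k - i + r) - nat_var (k - i + s)).

Lemma tableau_sum_invalid i nu : ~~ rect_partition i nu -> tableau_sum i nu = 0.
Proof.
case: i => [|i] /=; first by rewrite rect_partition0 => /negbTE ->.
by move=> /negbTE vnu; rewrite big1 // => mu _; rewrite /strip_step vnu mul0r.
Qed.

Lemma vandermonde_tailS i : (i < k)%N -> vandermonde_tail i.+1 =
  \prod_(j < i) (nat_var (k - i.+1) - nat_var (k - i.+1 + j.+1)) * vandermonde_tail i.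
Proof.
move=> ik; rewrite /vandermonde_tail big_ord_recl; congr (_ * _).
  rewrite big_mkcond big_ord_recl /= mul1r; apply: eq_bigr => j _.
  by rewrite addn0.
apply: eq_bigr => r _; rewrite big_mkcond big_ord_recl /= mul1r.
rewrite [RHS]big_mkcond /=; apply: eq_bigr => s _.
by rewrite /bump /= !add1n ltnS !addnS -!addSn subnSK.
Qed.

Lemma strip_weightE i mu nu :
  (i < k)%N -> rect_partition i.+1 nu -> rect_partition i mu ->
  strip_weight i mu nu =
  \prod_(0 <= c < nat_rows nu i) (nat_var (k - i.+1) - (y (i.+1 + c - i))%:MP) *
  \prod_(r < i) \prod_(nat_rows mu r <= c < nat_rows nu r)
     (nat_var (k - i.+1) - (y (i.+1 + c - r))%:MP).
Proof.
move=> ik vnu vmu.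
have [_ _ nu0] := rect_partition_nat vnu; have [_ _ mu0] := rect_partition_nat vmu.
pose G r := \prod_(nat_rows mu r <= c < nat_rows nu r)
     (nat_var (k - i.+1) - (y (i.+1 + c - r))%:MP).
rewrite [LHS](_ : _ = \prod_(0 <= r < k) G r); last first.
  by rewrite big_mkord; apply: eq_bigr => r _; rewrite /G !nat_rowsE.
rewrite (big_cat_nat (n := i.+1)) //= [X in _ * X]big_nat [X in _ * X]big1 ?mulr1; last first.
  by move=> r /andP[ir _]; rewrite /G nu0 // big_geq.
by rewrite big_nat_recr //= mulrC big_mkord {1}/G mu0.
Qed.

(** One level of the recursion is one use of the branching rule.  The
    interlacing row lengths of that rule range over functions on ['I_i]; extending
    them by zero identifies them with the partitions in the tableau recursion. *)
Lemma tableau_sum_alternant i nu : (i <= k)%N -> rect_partition i nu ->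
  tableau_sum i nu * vandermonde_tail i =
  altdet (fun p => (y p)%:MP) i (staircase i (nat_rows nu))
         (fun j => nat_var (k - i + j)).
Proof.
elim: i nu => [|i IHi] nu ik vnu.
  rewrite /vandermonde_tail /altdet det_mx00 big_ord0 mulr1 /=.
  by rewrite -rect_partition0 vnu.
have [nud nun nu0] := rect_partition_nat vnu.
rewrite (@altdet_branch _ _ n) => [|r _]; last first.
  by rewrite nud (leq_trans (nun _)) // leq_subr.
rewrite vandermonde_tailS // mulrCA addn0; congr (_ * _).
rewrite /= big_distrl /=.
rewrite (bigID (rect_partition i)) /= [X in _ + X]big1 ?addr0; last first.
  by move=> mu vmu; rewrite tableau_sum_invalid // mulr0 mul0r.
pose ext (g : {ffun 'I_i -> 'I_n.+1}) : X :=
  [ffun r : 'I_k => if insub (r : nat) is Some r' then g r' else ord0].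
pose res (mu : X) : {ffun 'I_i -> 'I_n.+1} :=
  [ffun r => mu (widen_ord (ltnW ik) r)].
have extK g : res (ext g) = g.
  by apply/ffunP => r; rewrite !ffunE /= valK.
rewrite (bigID (fun mu => strip_step i mu nu)) /= [X in _ + X]big1 ?addr0; last first.
  by move=> mu /andP[_ /negbTE ->]; rewrite !mul0r.
rewrite (reindex_onto ext res) /=; last first.
  move=> mu /andP[vmu _]; apply/ffunP => r; rewrite !ffunE.
  case: insubP => [s _ sr|].
    by rewrite ffunE; congr (mu _); apply/val_inj.
  rewrite -leqNgt => ir; apply/val_inj.
  have [_ _ mu0] := rect_partition_nat vmu.
  by rewrite -[RHS]/(nat_of_ord (mu r)) -nat_rowsE mu0.
have extE (g : {ffun 'I_i -> 'I_n.+1}) (r : 'I_i) : nat_rows (ext g) r = g r.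
  have := nat_rowsE (ext g) (widen_ord (ltnW ik) r); rewrite /= => ->.
  by rewrite ffunE /= valK.
apply: eq_big => [g|g].
  rewrite extK eqxx andbT.
  have ext0 (r : 'I_k) : (i <= r)%N -> ext g r = ord0.
    by move=> ir; rewrite ffunE; case: insubP => // s; rewrite ltnNge ir.
  have extl (r : 'I_k) (ri : (r < i)%N) : ext g r = g (Ordinal ri).
    by rewrite ffunE insubT.
  apply/andP/forallP => [[vg] | gP].
    rewrite strip_stepP // => /forallP eP r; have := eP (widen_ord (ltnW ik) r).
    rewrite -!nat_rowsE /= extE; exact.
  have nuanti r s : (r <= s)%N -> (nat_rows nu s <= nat_rows nu r)%N.
    move=> /subnKC <-; elim: (s - r)%N => [|d IHd]; first by rewrite addn0.
    by rewrite addnS (leq_trans (nud _)).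
  have vg : rect_partition i (ext g).
    apply/andP; split; apply/forallP => r.
      apply/forallP => s; apply/implyP => rs; rewrite /row_lengths.
      have [si|is_] := ltnP s i; last by rewrite ext0.
      have [rs_|] := ltnP r s; last first.
        by move=> sr; have /val_inj-> : r = s :> nat by apply/eqP; rewrite eqn_leq rs.
      have ri := ltn_trans rs_ si; rewrite !extl.
      have /andP[_ +] := gP (Ordinal si); have /andP[+ _] := gP (Ordinal ri).
      move=> /= g1 g2; rewrite (leq_trans g2) // (leq_trans _ g1) //.
      exact: nuanti.
    rewrite /row_lengths; have [ri|ir] := ltnP r i; last by rewrite ext0.
    rewrite extl implyFb andbT; have /andP[_ /= g2] := gP (Ordinal ri).
    by rewrite (leq_trans g2) // (leq_trans (nun _)) // leq_sub2l.
  split=> //; rewrite strip_stepP //; apply/forallP => r.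
  have [ri|ir] := ltnP r i.
    have := gP (Ordinal ri); rewrite extl /= -nat_rowsE; exact.
  by rewrite ext0 //= nu0.
rewrite extK eqxx andbT => /andP[vg sg].
rewrite sg -[LHS]mulrA.
rewrite [X in _ * X = _](IHi _ (ltnW ik) vg) [X in X * _ = _](strip_weightE ik vnu vg).
apply: congr2.
  by apply: congr2 => //; apply: eq_bigr => r _; rewrite extE.
congr (\det _); apply/matrixP => r j; rewrite !mxE /staircase extE.
congr (ffact _ (nat_var _) _).
by rewrite addnS -addSn subnSK.
Qed.

End TableauFormula.

Section FschurTableaux.
Variables (n k : nat) (L : comNzRingType) (y : nat -> L).

Local Notation X := {ffun 'I_k -> 'I_n.+1}.

Lemma ssytE (nu : X) (T : part_chain n k) :
  ssyt (row_lengths nu) T = [&& T ord0 == [ffun=> ord0], T ord_max == nu &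
    [forall i : 'I_k, strip_step i (T (widen_ord (leqnSn k) i)) (T (lift ord0 i))]].
Proof.
have partE (mu mu' : X) :
    [forall r, row_lengths mu r == row_lengths mu' r] = (mu == mu').
  apply/forallP/eqP => [E|-> //]; apply/ffunP => r.
  exact/val_inj/eqP/E.
rewrite /ssyt [X in [&& X, _ & _]](_ : _ = (T ord0 == [ffun=> ord0])); last first.
  by rewrite -partE; apply: eq_forallb => r; rewrite /row_lengths ffunE.
rewrite [X in [&& _, X & _]](_ : _ = (T ord_max == nu)); last exact: partE.
have [T0|//] := eqVneq (T ord0) [ffun=> ord0].
have [Tk|//] := eqVneq (T ord_max) nu; rewrite !andTb.
apply/andP/forallP => [[/forallP vT /forallP sT] i|sT].
  by rewrite /strip_step; apply/andP; split; [apply: (vT (lift ord0 i)) | apply: sT].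
split; apply/forallP => i.
  have [-> | [j ->]] : i = ord0 \/ exists j, i = lift ord0 j.
    by case: (unliftP ord0 i) => [j ->|]; [right; exists j|left].
    by have V : rect_partition 0 (T ord0) by rewrite rect_partition0 T0.
  by have /andP[] := sT j.
by have /andP[] := sT i.
Qed.

Lemma altdet_vandermonde (nu : X) :
  altdet (fun p => (y p)%:MP) k (staircase k (nat_rows nu)) (nat_var k L) =
  fschur y (row_lengths nu) * vandermonde k L.
Proof.
rewrite fschurE; congr (\det _); apply/matrixP => i j.
by rewrite !mxE /ffact /fpow /staircase nat_varE nat_rowsE.
Qed.

(** Each chain contributes the product, over the boxes of the strip added at
    level k - j, of linear factors in the variable x_j, j counted from 0. *)
Lemma fschur_tableaux (la : 'I_k -> nat) :
  is_partition la -> fits k (n - k) la ->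
  fschur y la = \sum_(T : part_chain n k | ssyt la T) \prod_(j < k) \prod_(r < k)
    \prod_(part_pred T (rev_ord j) r <= c < part_succ T (rev_ord j) r)
       ('X_j - (y (k - j + c - r))%:MP).
Proof.
move=> pla fla.
pose nu : X := [ffun r => inord (la r)].
have laE : la = row_lengths nu.
  apply/boolp.funext => r; rewrite /row_lengths ffunE inordK // ltnS.
  by case/andP: (forallP fla r) => /leq_trans -> //; rewrite leq_subr.
have vnu : rect_partition k nu by rewrite /rect_partition -laE pla.
rewrite laE; move: (nu) vnu => {nu laE pla fla}nu vnu.
transitivity (tableau_sum y k nu).
  apply: (@vandermonde_lreg k L); rewrite ![vandermonde k L * _]mulrC.
  have vdmE : vandermonde_tail k L k = vandermonde k L.
    apply: eq_bigr => i _; apply: eq_bigr => j _.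
    by rewrite subnn !add0n !nat_varE.
  rewrite -altdet_vandermonde -vdmE tableau_sum_alternant //.
  by congr (altdet _ _ _ _); apply/boolp.funext => j; rewrite subnn.
pose E i mu nu := if @strip_step n k i mu nu then strip_weight y i mu nu else 0.
rewrite (path_sum (x0 := [ffun=> ord0]) (E := E) (F := tableau_sum y)) //.
rewrite [LHS]big_mkcond [RHS]big_mkcond; apply: eq_bigr => T _.
rewrite ssytE andbA; case: ifP => //= _; case: forallP => [sT|nsT]; last first.
  have [i] : exists i : 'I_k, ~~ strip_step i (T (widen_ord (leqnSn k) i)) (T (lift ord0 i)).
    by apply/existsP; rewrite -negb_forall; apply/forallP.
  by move=> /negbTE si; rewrite (bigD1 i) //= /E si mul0r.
rewrite (reindex_inj rev_ord_inj) /=; apply: eq_bigr => j _.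
have /= sj := sT (rev_ord j); rewrite /E sj /strip_weight; apply: eq_bigr => r _.
have kj : ((k - j.+1).+1 = k - j)%N by rewrite subnSK.
rewrite [X in nat_var _ _ (k - X)%N]kj subKn ?(ltnW (ltn_ord j)) //.
by apply: eq_bigr => c _; rewrite nat_varE kj.
Qed.

End FschurTableaux.

(** * Wedge products as minors *)

Section WedgeMinors.
Variables (n : nat) (L : comNzRingType).

Local Notation ltI := (fun i j : 'I_n => (i < j)%N).

(** Removing the p-th element of an increasing list accounts for both the sign
    and the index set in the p-th term of a wedge. *)
Lemma sorted_split (i0 : 'I_n) (a : seq 'I_n) p :
  sorted ltI a -> (p < size a)%N ->
  [/\ [set j in [set x in a] | (j < nth i0 a p)%N] = [set x in take p a],
      [set x in a] :\ nth i0 a p = [set x in take p a ++ drop p.+1 a] &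
      sorted ltI (take p a ++ drop p.+1 a)].
Proof.
move=> sa pa.
have lt_trans : transitive ltI by move=> ? ? ?; apply: ltn_trans.
have aE : a = take p a ++ nth i0 a p :: drop p.+1 a.
  by rewrite -drop_nth // cat_take_drop.
move: sa; rewrite {1}aE -cat1s catA => sa.
have sub : subseq (take p a ++ drop p.+1 a)
    ((take p a ++ [:: nth i0 a p]) ++ drop p.+1 a).
  by rewrite -catA; apply: cat_subseq => //; apply: suffix_subseq.
split; last exact: subseq_sorted sub sa.
  apply/setP => x; rewrite !inE {1}aE mem_cat inE.
  move: sa; rewrite -catA /= sorted_pairwise // pairwise_cat /=.
  case/and3P=> [/allrelP td _ /andP[/allP ad _]].
  have [xt|xt] /= := boolP (x \in take p a).
    by rewrite td // mem_head.
  have [->|nx] /= := eqVneq x (nth i0 a p); first by rewrite ltnn.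
  have [/ad xd|//] := boolP (x \in drop p.+1 a).
  by rewrite ltnNge ltnW.
apply/setP => x; rewrite !inE {2}aE !mem_cat inE.
have [->|//] /= := eqVneq x (nth i0 a p).
move: sa; rewrite -catA /= sorted_pairwise // pairwise_cat /=.
case/and3P=> [/allrelP td _ /andP[/allP ad _]].
apply/esym/negbTE; rewrite negb_or; apply/andP; split; apply/negP.
  by move/td => /(_ _ (mem_head _ _)); rewrite ltnn.
by move/ad; rewrite ltnn.
Qed.

(** The definition of [wedge] is the Laplace expansion of a minor along its
    first column. *)
Lemma foldr_wedge_minor (i0 : 'I_n) m (s : seq 'cV[L]_n) (a : seq 'I_n) :
  size s = m -> size a = m -> sorted ltI a ->
  foldr (@wedge n L) (ext1 n L) s [set x in a] =
  \det (\matrix_(i < m, j < m) nth 0 s j (nth i0 a i) 0).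
Proof.
have lt_trans : transitive ltI by move=> ? ? ?; apply: ltn_trans.
elim: m => [|m IHm] in s a *.
  move=> /size0nil -> /size0nil -> _; rewrite det_mx00 /= ffunE.
  by rewrite (_ : [set x in [::]] = set0) ?eqxx //; apply/setP => x; rewrite !inE.
case: s => // v s [ss] sza sa; rewrite /= ffunE.
have ua : uniq a by apply: sorted_uniq sa => // x; rewrite ltnn.
rewrite (eq_bigl (mem a)) => [|x]; last by rewrite inE.
rewrite -big_uniq //= (big_nth i0) big_mkord sza.
rewrite [RHS](expand_det_col _ ord0); apply: eq_bigr => p _.
have pa : (p < size a)%N by rewrite sza.
have [-> -> sa'] := sorted_split i0 sa pa.
rewrite mxE /= -mulrA mulrCA; congr (_ * _).
have szt : size (take p a) = p by rewrite size_take pa.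
have -> : #|[set x in take p a]| = p.
  by rewrite cardsE (card_uniqP _) ?take_uniq.
rewrite /cofactor addn0 (IHm _ _ ss) //; last first.
  by rewrite size_cat szt size_drop sza subSS subnKC // -ltnS.
congr (_ * \det _); apply/matrixP => i j; rewrite !mxE lift0 /=.
congr (nth 0 s j _ 0); rewrite nth_cat szt /bump.
case: ltnP => ip; first by rewrite nth_take.
by rewrite nth_drop add1n addSn subnKC.
Qed.

End WedgeMinors.

Section WedgesCoordinates.
Variables (n k : nat) (hk : (k <= n)%N) (L : comNzRingType).

Lemma coord_wedges (w : 'S_n) (v : 'I_k -> 'cV[L]_n) : grassmannian k w ->
  coord hk w (wedges v) = \det (\matrix_(i, j) v j (gfun hk w i) 0).
Proof.
move=> gw; rewrite /coord -gset_seq.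
case: k hk v gw => [|k'] hk' v gw.
  rewrite det_mx00 /= -[enum 'I_0](_ : [::] = _) /=; last first.
    by apply/esym/size0nil; rewrite size_enum_ord.
  by rewrite ffunE (_ : [set i in [::]] = set0) ?eqxx //; apply/setP => x; rewrite !inE.
have i0 : 'I_n by apply: (gfun hk' w ord0).
rewrite /wedges [LHS](foldr_wedge_minor i0 (m := k'.+1)) //.
- congr (\det _); apply/matrixP => i j; rewrite !mxE.
  have nthE (T : Type) (f : 'I_k'.+1 -> T) x0 l :
      nth x0 [seq f j | j <- enum 'I_k'.+1] (l : 'I_k'.+1) = f l.
    by rewrite (nth_map ord0) ?size_enum_ord // nth_ord_enum.
  by rewrite !nthE.
- by rewrite size_map size_enum_ord.
- by rewrite size_map size_enum_ord.
- exact: gfun_sorted.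
Qed.

(** List A increasingly, then its complement increasingly. *)
Lemma grassmannian_exists (A : {set 'I_n}) : #|A| = k ->
  exists2 w : 'S_n, grassmannian k w & A = [set gfun hk w j | j : 'I_k].
Proof.
move=> Ak.
pose s := enum A ++ enum (~: A).
have sz : size s = n.
  by rewrite size_cat -!cardE cardsC card_ord.
have us : uniq s.
  rewrite cat_uniq !enum_uniq /= andbT; apply/hasPn => x.
  by rewrite !mem_enum inE.
pose f (i : 'I_n) := nth i s i.
have fi : injective f.
  move=> i j; rewrite /f (set_nth_default i) ?sz //.
  by move/eqP; rewrite nth_uniq ?sz // => /eqP/val_inj.
have enum_lt (B : {set 'I_n}) i j x y : (i < j < #|B|)%N ->
    (nth x (enum B) i < nth y (enum B) j)%N.
  case/andP=> ij jB; rewrite (set_nth_default x) -?cardE //.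
  have sB : sorted (fun i j : 'I_n => i < j)%N (enum B).
    rewrite /enum_mem -enumT; apply: sorted_filter; last exact: sorted_enum_ord.
    by move=> ? ? ?; apply: ltn_trans.
  apply: (sorted_ltn_nth _ x sB) => //; rewrite ?inE -?cardE //.
  - by move=> ? ? ?; apply: ltn_trans.
  - exact: ltn_trans jB.
exists (perm fi).
  apply/forallP => i; apply/forallP => j; apply/implyP => /andP[ij].
  rewrite !permE /f /s !nth_cat -!cardE Ak => /orP[jk|ki].
    by rewrite jk (ltn_trans ij) // enum_lt // ij Ak.
  rewrite (ltnNge i k) (ltnNge j k) ki (leq_trans ki (ltnW ij)) /=.
  have kj := leq_ltn_trans ki ij.
  apply: enum_lt; rewrite ltn_sub2r //= ltn_subLR ?(ltnW kj) //.
  by rewrite -[X in (_ < X + _)%N]Ak cardsC card_ord.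
apply/eqP; rewrite eq_sym eqEcard; apply/andP; split.
  apply/subsetP => x /imsetP[j _ ->]; rewrite ffunE permE /f /s nth_cat -cardE Ak /=.
  by rewrite ltn_ord -mem_enum mem_nth // -cardE Ak.
rewrite card_imset ?card_ord ?Ak // => i j; rewrite !ffunE => /perm_inj.
by move/(congr1 val) => /= /val_inj.
Qed.

Lemma extpow_coord_inj (x x' : extpow n L k) :
  (forall w, grassmannian k w -> coord hk w x = coord hk w x') -> x = x'.
Proof.
move=> xx'; apply/val_inj/ffunP => A.
have [Ak|nAk] := eqVneq #|A| k; last first.
  have /homogeneousP-> := valP x => //.
  by have /homogeneousP-> := valP x'.
have [w gw ->] := grassmannian_exists Ak.
exact: xx'.
Qed.

Lemma coordD (w : 'S_n) (x x' : extpow n L k) :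
  coord hk w (x + x') = coord hk w x + coord hk w x'.
Proof. by rewrite /coord /= ffunE. Qed.

Lemma coordZ (w : 'S_n) c (x : extpow n L k) :
  coord hk w (c *: x) = c * coord hk w x.
Proof. by rewrite /coord /= ffunE. Qed.

HB.instance Definition _ (w : 'S_n) :=
  GRing.isLinear.Build L (extpow n L k) L *%R (coord hk w)
    (fun c x y => etrans (coordD w (c *: x) y) (congr1 (+%R^~ _) (coordZ w c x))).

Lemma coord_sum (w : 'S_n) I (r : seq I) P (F : I -> extpow n L k) :
  coord hk w (\sum_(i <- r | P i) F i) = \sum_(i <- r | P i) coord hk w (F i).
Proof. exact: linear_sum. Qed.

Lemma sum_coord_ket (x : extpow n L k) :
  x = \sum_(w | grassmannian k w) coord hk w x *: ket hk L w.
Proof.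
apply: extpow_coord_inj => u gu; rewrite coord_sum (bigD1 u) //= big1.
  by rewrite coordZ coord_ket // eqxx mulr1 addr0.
by move=> w /andP[gw nw]; rewrite coordZ coord_ket // eq_sym (negbTE nw) mulr0.
Qed.

(** Read on coordinates, this is multilinearity of minors in their columns. *)
Lemma wedges_multilinear (X : finType) (c : 'I_k -> X -> L)
    (v : 'I_k -> X -> 'cV[L]_n) :
  wedges (fun j => \sum_a c j a *: v j a) =
  \sum_(f : {ffun 'I_k -> X}) (\prod_j c j (f j)) *: wedges (fun j => v j (f j)).
Proof.
apply: extpow_coord_inj => w gw; rewrite coord_wedges // coord_sum.
rewrite -det_tr.
have -> : (\matrix_(i, j) (\sum_a c j a *: v j a) (gfun hk w i) 0)^T =
    \matrix_(j, i) \sum_a c j a * v j a (gfun hk w i) 0.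
  apply/matrixP => j i; rewrite !mxE summxE; apply: eq_bigr => a _.
  by rewrite mxE.
rewrite (det_sum_rows c (fun j a i => v j a (gfun hk w i) 0)).
apply: eq_bigr => f _; rewrite coordZ coord_wedges // -det_tr.
by congr (_ * \det _); apply/matrixP => i j; rewrite !mxE.
Qed.

Lemma wedges_perm (s : 'S_k) (v : 'I_k -> 'cV[L]_n) :
  wedges (fun j => v (s j)) = (-1) ^+ s *: wedges v.
Proof.
apply: extpow_coord_inj => w gw; rewrite coordZ !coord_wedges //.
rewrite [X in \det X](_ : _ =
  col_perm s (\matrix_(i, j) v j (gfun hk w i) 0)); last first.
  by apply/matrixP => i j; rewrite !mxE.
by rewrite col_permE det_mulmx det_perm odd_permV mulrC.
Qed.

Lemma wedges_alternate (v : 'I_k -> 'cV[L]_n) i j :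
  i != j -> v i = v j -> wedges v = 0.
Proof.
move=> nij vij; apply: extpow_coord_inj => w gw; rewrite coord_wedges //.
rewrite -det_tr (determinant_alternate nij) ?linear0 // => a.
by rewrite !mxE vij.
Qed.

Lemma eq_wedges (v v' : 'I_k -> 'cV[L]_n) : v =1 v' -> wedges v = wedges v'.
Proof. by move=> /boolp.funext ->. Qed.

End WedgesCoordinates.

(** * Polynomial functional calculus on wedges *)

Section UnivariateSubstitution.
Variables (k : nat) (L : comNzRingType).

Definition uvar (j : 'I_k) (p : {poly L}) : {mpoly L[k]} :=
  (map_poly (@mpolyC k L) p).['X_j].

Lemma uvar_zmod_morphism j : zmod_morphism (uvar j).
Proof. by move=> p r; rewrite /uvar rmorphB hornerD hornerN. Qed.

Lemma uvar_monoid_morphism j : monoid_morphism (uvar j).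
Proof.
split=> [|p r]; first by rewrite /uvar rmorph1 hornerC.
by rewrite /uvar rmorphM hornerM.
Qed.

Lemma uvar_scalable j : scalable (uvar j).
Proof. by move=> c p; rewrite /uvar map_polyZ hornerZ mul_mpolyC. Qed.

HB.instance Definition _ j :=
  GRing.isZmodMorphism.Build {poly L} {mpoly L[k]} (uvar j) (uvar_zmod_morphism j).
HB.instance Definition _ j :=
  GRing.isMonoidMorphism.Build {poly L} {mpoly L[k]} (uvar j)
    (uvar_monoid_morphism j).
HB.instance Definition _ j :=
  GRing.isScalable.Build L {poly L} {mpoly L[k]} *:%R (uvar j) (uvar_scalable j).

Lemma uvarX j : uvar j 'X = 'X_j.
Proof. by rewrite /uvar map_polyX hornerX. Qed.

Lemma uvarXn j m : uvar j 'X^m = 'X_j ^+ m.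
Proof. by rewrite rmorphXn /= uvarX. Qed.

Lemma uvarC j c : uvar j c%:P = c%:MP.
Proof. by rewrite /uvar map_polyC hornerC. Qed.

Lemma prod_uvarXn (m : 'X_{1..k}) : \prod_j uvar j 'X^(m j) = 'X_[m].
Proof. by rewrite mpolyXE_id; apply: eq_bigr => j _; rewrite uvarXn. Qed.

End UnivariateSubstitution.

Lemma poly_widen (L : nzRingType) (p : {poly L}) N : (size p <= N)%N ->
  p = \sum_(a < N) p`_a *: 'X^a.
Proof.
move=> pN; rewrite -[LHS]coefK poly_def.
rewrite (big_ord_widen N (fun a => p`_a *: 'X^a)) // big_mkcond.
apply: eq_bigr => a _; case: ltnP => // ?.
by rewrite nth_default // scale0r.
Qed.

Section WedgeEvaluation.
Variables (n' k : nat) (hk : (k <= n'.+1)%N) (L : comNzRingType).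
Variable M : 'M[L]_n'.+1.
Local Notation n := n'.+1.

Definition pure_tensor (v : 'I_k -> 'cV[L]_n) : tensor n k L :=
  [ffun f : {ffun 'I_k -> 'I_n} => \prod_j v j (f j) 0].

Lemma tensor_act_pure i v : tensor_act M i (pure_tensor v) =
  pure_tensor (fun j => if j == i then M *m v j else v j).
Proof.
apply/ffunP => f; rewrite !ffunE (bigD1 i) //= eqxx mxE big_distrl /=.
apply: eq_bigr => a _; rewrite ffunE (bigD1 i) //= ffunE eqxx mulrA.
congr (_ * _); apply: eq_bigr => j /negbTE nj.
by rewrite ffunE nj.
Qed.

Lemma eq_pure (v v' : 'I_k -> 'cV[L]_n) : v =1 v' -> pure_tensor v = pure_tensor v'.
Proof. by move=> /boolp.funext ->. Qed.

Lemma tensor_monomial_pure (m : 'X_{1..k}) v :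
  foldr (fun i => iter (m i) (tensor_act M i)) (pure_tensor v) (enum 'I_k) =
  pure_tensor (fun j => M ^+ m j *m v j).
Proof.
have iterE i d u : iter d (tensor_act M i) (pure_tensor u) =
    pure_tensor (fun j => if j == i then M ^+ d *m u j else u j).
  elim: d => [|d IHd]; first by apply: eq_pure => j; rewrite mul1mx if_same.
  rewrite iterS IHd tensor_act_pure; apply: eq_pure => j.
  by case: (j == i); rewrite // mulmxA exprS.
transitivity (pure_tensor (fun j => if j \in enum 'I_k then M ^+ m j *m v j else v j)).
  elim: (enum 'I_k) (enum_uniq 'I_k) => //= i s IHs /andP[nis us].
  rewrite IHs // iterE; apply: eq_pure => j; rewrite inE.
  by case: eqP => [->|//]; rewrite (negbTE nis).
by apply: eq_pure => j; rewrite mem_enum.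
Qed.

(** The image in the exterior power of p(M_1, ..., M_k) applied to the tensor
    of the v_j, see [tensor_ext_poly]. *)
Definition wedge_eval (v : 'I_k -> 'cV[L]_n) (p : {mpoly L[k]}) : extpow n L k :=
  \sum_(m <- msupp p) p@_m *: wedges (fun j => M ^+ m j *m v j).

Lemma tensor_ext_pure v : tensor_ext (pure_tensor v) = wedges v.
Proof.
have vE : v =1 (fun j => \sum_a v j a 0 *: delta_mx a 0).
  move=> j; rewrite {1}[v j]matrix_sum_delta; apply: eq_bigr => a _.
  by rewrite big_ord1.
rewrite (eq_wedges vE) (wedges_multilinear hk (fun j a => v j a 0)).
by apply: eq_bigr => f _; rewrite ffunE.
Qed.

Lemma tensor_ext_poly v p :
  tensor_ext (tensor_poly M p (pure_tensor v)) = wedge_eval v p.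
Proof.
rewrite /tensor_poly /tensor_ext.
under eq_bigr => f _ do rewrite sum_ffunE scaler_suml.
rewrite exchange_big /=; apply: eq_bigr => m _.
rewrite tensor_monomial_pure -tensor_ext_pure scaler_sumr.
by apply: eq_bigr => f _; rewrite ffunE scalerA.
Qed.

(** Summing over a fixed finite set of monomials makes linearity in p
    visible. *)
Lemma wedge_eval_bounded v p d : (msize p <= d)%N -> wedge_eval v p =
  \sum_(m : 'X_{1..k < d}) p@_m *: wedges (fun j => M ^+ m j *m v j).
Proof.
move=> pd; pose I : subFinType _ := 'X_{1..k < d}.
rewrite /wedge_eval (ssrcomplements.big_mksub I) //=; first last.
- by move=> x /msize_mdeg_lt /leq_trans; apply.
- exact: msupp_uniq.
rewrite big_rmcond //= => m.
by move/memN_msupp_eq0 => ->; rewrite scale0r.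
Qed.

Lemma wedge_eval_is_linear v : linear (wedge_eval v).
Proof.
move=> c p r; pose d := maxn (msize (c *: p + r)) (maxn (msize p) (msize r)).
rewrite !(@wedge_eval_bounded _ _ d) ?leq_max ?leqnn ?orbT // scaler_sumr -big_split /=.
by apply: eq_bigr => m _; rewrite mcoeffD mcoeffZ scalerDl scalerA.
Qed.

HB.instance Definition _ v :=
  GRing.isLinear.Build L {mpoly L[k]} (extpow n L k) *:%R (wedge_eval v)
    (wedge_eval_is_linear v).

Lemma wedge_evalX v m : wedge_eval v 'X_[m] = wedges (fun j => M ^+ m j *m v j).
Proof. by rewrite /wedge_eval msuppX big_seq1 mcoeffX eqxx scale1r. Qed.

Lemma wedge_eval_prod v (g : 'I_k -> {poly L}) :
  wedge_eval v (\prod_j uvar j (g j)) = wedges (fun j => horner_mx M (g j) *m v j).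
Proof.
pose N := \max_j size (g j).
have gE j : g j = \sum_(a < N) (g j)`_a *: 'X^a.
  by apply: poly_widen; apply: (leq_bigmax j).
have -> : \prod_j uvar j (g j) = \sum_(f : {ffun 'I_k -> 'I_N})
    (\prod_j (g j)`_(f j)) *: 'X_[[multinom f j : nat | j < k]].
  under eq_bigr => j _ do rewrite (gE j) linear_sum /=.
  rewrite bigA_distr_bigA; apply: eq_bigr => f _ /=.
  under eq_bigr => j _ do rewrite linearZ /= uvarXn.
  rewrite scaler_prod mpolyXE_id; congr (_ *: _).
  by apply: eq_bigr => j _; rewrite mnmE.
rewrite linear_sum /=.
have vE : (fun j => horner_mx M (g j) *m v j) =1
    (fun j => \sum_(a < N) (g j)`_a *: (M ^+ a *m v j)).
  move=> j; rewrite {1}(gE j) linear_sum mulmx_suml; apply: eq_bigr => a _ /=.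
  by rewrite linearZ rmorphXn /= horner_mx_X scalemxAl.
rewrite (eq_wedges vE) (wedges_multilinear hk (fun j (a : 'I_N) => (g j)`_a)).
apply: eq_bigr => f _; rewrite linearZ /= wedge_evalX; congr (_ *: _).
by apply: eq_wedges => j; rewrite mnmE.
Qed.

(** Factors in separate variables act on separate wedge factors, so they can be
    absorbed into the vectors. *)
Lemma wedge_eval_mul_prod v p (g : 'I_k -> {poly L}) :
  wedge_eval v (p * \prod_j uvar j (g j)) =
  wedge_eval (fun j => horner_mx M (g j) *m v j) p.
Proof.
rewrite [p]mpolyE big_distrl !linear_sum /=; apply: eq_bigr => m _.
rewrite -scalerAl !linearZ /= wedge_evalX; congr (_ *: _).
rewrite -prod_uvarXn -big_split /=.
under eq_bigr => j _ do rewrite -rmorphM.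
rewrite wedge_eval_prod; apply: eq_wedges => j.
by rewrite rmorphM rmorphXn /= horner_mx_X mulmxA.
Qed.

End WedgeEvaluation.

(** * Antisymmetrisation divided by the Vandermonde determinant *)

Section Antisymmetrization.
Variables (k : nat) (L : comNzRingType).
Local Notation MP := {mpoly L[k]}.

Lemma sympoly_valM (p r : sympoly k L) :
  sympoly_val (p * r) = sympoly_val p * sympoly_val r.
Proof. by []. Qed.

Lemma sympoly_valZ c (p : sympoly k L) :
  sympoly_val (c *: p) = c *: sympoly_val p.
Proof. by []. Qed.

Lemma msym_uvar (s : 'S_k) j g : msym s (uvar j g) = uvar (s j) g :> MP.
Proof.
rewrite (poly_widen (leqnn (size g))) !linear_sum /=.
apply: eq_bigr => a _; rewrite !linearZ /= !uvarXn rmorphXn /=.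
by congr (_ *: _ ^+ _); rewrite /msym mmapX mmap1U.
Qed.

Definition alternation (f : MP) : MP := \sum_(s : 'S_k) (-1) ^+ s * msym s f.

Lemma alternation_prod (g : 'I_k -> {poly L}) :
  alternation (\prod_j uvar j (g j)) = \det (\matrix_(i, j) uvar j (g i)).
Proof.
apply: eq_bigr => s _; rewrite rmorph_prod; congr (_ * _).
by apply: eq_bigr => i _ /=; rewrite msym_uvar mxE.
Qed.

Lemma alternation_linear : linear alternation.
Proof.
move=> c f g; rewrite /alternation scaler_sumr -big_split /=.
by apply: eq_bigr => s _; rewrite linearP /= mulrDr scalerAr.
Qed.

Lemma alternation_symM p f : p \is symmetric ->
  alternation (p * f) = p * alternation f.
Proof.
move=> /issymP ps; rewrite /alternation big_distrr /=.
by apply: eq_bigr => s _; rewrite msymM ps mulrCA.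
Qed.

Lemma msym_alternation (s : 'S_k) f :
  msym s (alternation f) = (-1) ^+ s * alternation f.
Proof.
rewrite /alternation rmorph_sum big_distrr /=.
rewrite [RHS](reindex_inj (mulIg s)) /=; apply: eq_bigr => t _.
rewrite msymMm rmorphM rmorph_sign odd_permM signr_addb mulrA.
by rewrite [_ * ((-1) ^+ t * _)]mulrCA -signr_addb addbb mulr1.
Qed.

(** This order of factors, opposite to that of [vandermonde], makes [divsym]
    free of signs on products listed in increasing order. *)
Definition incr_vandermonde : MP := \det (Vandermonde k (\row_j 'X_j)).

Lemma det_rev_rows (A : 'M[MP]_k) :
  \det (\matrix_(i, j) A (rev_ord i) j) =
  (-1) ^+ (perm (@rev_ord_inj k)) * \det A.
Proof.
rewrite (_ : \matrix_(_, _) _ = row_perm (perm (@rev_ord_inj k)) A); last first.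
  by apply/matrixP => i j; rewrite !mxE permE.
by rewrite row_permE det_mulmx det_perm.
Qed.

(** The sign is that of the order-reversing permutation; it is the same sign
    that relates the decreasing exponents of [alternant] to increasing ones. *)
Lemma vandermondeE :
  vandermonde k L = (-1) ^+ (perm (@rev_ord_inj k)) * incr_vandermonde.
Proof.
pose A : 'M[MP]_k := \matrix_(i, j) 'X_(rev_ord j) ^+ i.
have -> : vandermonde k L = \det A.
  rewrite (_ : A = Vandermonde k (\row_j 'X_(rev_ord j))); last first.
    by apply/matrixP => i j; rewrite !mxE.
  rewrite det_Vandermonde /vandermonde.
  rewrite (eq_bigr _ (fun i _ => big_mkcond _ _)) [RHS](eq_bigr _ (fun i _ => big_mkcond _ _)).
  rewrite pair_bigA [RHS]pair_bigA /=.
  have hK : involutive (fun ij : 'I_k * 'I_k => (rev_ord ij.2, rev_ord ij.1)).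
    by move=> [i j]; rewrite /= !rev_ordK.
  rewrite (reindex_inj (inv_inj hK)) /=.
  apply: eq_bigr => -[i j] _ /=; rewrite !mxE.
  by rewrite ltn_sub2lE // ltnS.
rewrite /incr_vandermonde -det_tr -[in RHS]det_tr -det_rev_rows.
by congr (\det _); apply/matrixP => i j; rewrite !mxE.
Qed.

Lemma incr_vandermonde_lreg : GRing.lreg incr_vandermonde.
Proof.
move=> f g fg; apply: (@vandermonde_lreg k L).
by rewrite vandermondeE -!mulrA fg.
Qed.

Lemma msym_incr_vandermonde (s : 'S_k) : msym s incr_vandermonde = (-1) ^+ s * incr_vandermonde.
Proof.
have := msym_vandermonde L s.
by rewrite vandermondeE rmorphM rmorph_sign mulrCA => /lreg_sign.
Qed.

(** It suffices to divide on monomials, where the antisymmetrisation is a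
    determinant of univariate polynomials evaluated at the variables.  The
    quotient is symmetric because numerator and denominator are both
    antisymmetric and the denominator is regular. *)
Lemma divsym_exists f :
  exists d : sympoly k L, sympoly_val d * incr_vandermonde == alternation f.
Proof.
have [d dE] : exists d, d * vandermonde k L = alternation f.
  elim/mpolyind: f => [|c m f _ _ [d dE]].
    by exists 0; rewrite mul0r /alternation big1 // => s _; rewrite rmorph0 mulr0.
  have [d' d'E] := alternant_dvd (fun j : 'I_k => 'X_j : MP)
    (fun i => 'X^(m i)).
  exists (c *: d' + d); rewrite alternation_linear mulrDl dE -scalerAl.
  congr (c *: _ + _); rewrite [LHS]d'E -prod_uvarXn alternation_prod.
  by congr (\det _); apply/matrixP => i j; rewrite !mxE hornerXn uvarXn.
pose d' := d * (-1) ^+ (perm (@rev_ord_inj k)).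
have d'E : d' * incr_vandermonde = alternation f by rewrite -mulrA -vandermondeE.
have d's : d' \is symmetric.
  apply/issymP => s; apply: incr_vandermonde_lreg; rewrite ![incr_vandermonde * _]mulrC.
  have := msym_alternation s f; rewrite -d'E rmorphM /= msym_incr_vandermonde mulrCA.
  by move/lreg_sign.
by exists (SymPoly d's); rewrite /= d'E.
Qed.

(** The divided difference operator attached to the longest permutation. *)
Definition divsym (f : MP) : sympoly k L :=
  xchoose (divsym_exists f).

Lemma divsymE f : sympoly_val (divsym f) * incr_vandermonde = alternation f.
Proof. exact/eqP/(xchooseP (divsym_exists f)). Qed.

Lemma divsym_unique f d : sympoly_val d * incr_vandermonde = alternation f -> divsym f = d.
Proof.
rewrite -divsymE => dE; apply/val_inj/incr_vandermonde_lreg => /=.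
by rewrite ![incr_vandermonde * _]mulrC.
Qed.

Lemma divsym_is_linear : linear divsym.
Proof.
move=> c f g; apply: divsym_unique.
rewrite alternation_linear -!divsymE /= mulrDl; congr (_ + _).
by rewrite -scalerAl.
Qed.

HB.instance Definition _ :=
  GRing.isLinear.Build L MP (sympoly k L) *:%R divsym divsym_is_linear.

Lemma divsymD f g : divsym (f + g) = divsym f + divsym g.
Proof. exact: raddfD. Qed.

Lemma divsym0 : divsym 0 = 0.
Proof. exact: raddf0. Qed.

Lemma divsymZ c f : divsym (c *: f) = c *: divsym f.
Proof. exact: linearZ_LR. Qed.

Lemma divsym_symM (p : sympoly k L) f :
  divsym (sympoly_val p * f) = p * divsym f.
Proof.
apply: divsym_unique; rewrite alternation_symM ?(valP p) // -divsymE.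
by rewrite sympoly_valM mulrA.
Qed.

Lemma divsym_alternate g (i j : 'I_k) : i != j -> g i = g j ->
  divsym (\prod_l uvar l (g l)) = 0.
Proof.
move=> nij gij; apply: divsym_unique; rewrite alternation_prod mul0r.
apply/esym/(determinant_alternate nij) => l.
by rewrite !mxE gij.
Qed.

Lemma divsym_perm g (s : 'S_k) :
  divsym (\prod_l uvar l (g (s l))) = (-1) ^+ s *: divsym (\prod_l uvar l (g l)).
Proof.
apply: divsym_unique.
rewrite sympoly_valZ -scalerAl divsymE !alternation_prod.
rewrite [X in _ = \det X](_ : _ = row_perm s (\matrix_(i, j) uvar j (g i))); last first.
  by apply/matrixP => i j; rewrite !mxE.
rewrite row_permE det_mulmx det_perm -mul_mpolyC.
by rewrite rmorph_sign.
Qed.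

(** When all degrees are below k, the matrix of values factors as the
    coefficient matrix times the Vandermonde matrix. *)
Lemma divsym_small (g : 'I_k -> {poly L}) : (forall i, (size (g i) <= k)%N) ->
  divsym (\prod_j uvar j (g j)) = (\det (\matrix_(i, j) (g i)`_j))%:A.
Proof.
move=> gk; apply: divsym_unique.
rewrite alternation_prod sympoly_valZ -scalerAl mul1r.
rewrite -mul_mpolyC -det_map_mx -det_mulmx; congr (\det _).
apply/matrixP => i j; rewrite !mxE [in RHS](poly_widen (gk i)) linear_sum.
by apply: eq_bigr => a _; rewrite linearZ /= uvarXn !mxE mul_mpolyC.
Qed.

End Antisymmetrization.

(** * Factorial powers and the ideal of quantum relations *)

Section FactorialPowers.
Variables (L : comNzRingType) (y : nat -> L).

Definition fpoly (m : nat) : {poly L} := ffact (fun p => (y p)%:P) 'X m.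

Lemma size_fpoly m : size (fpoly m) = m.+1.
Proof. by rewrite /fpoly /ffact size_prod_XsubC size_iota subn1. Qed.

Lemma fpoly_monic m : fpoly m \is monic.
Proof. exact: monic_prod_XsubC. Qed.

Lemma fpoly_lead m : (fpoly m)`_m = 1.
Proof. by have /monicP := fpoly_monic m; rewrite /lead_coef size_fpoly. Qed.

Lemma fpoly0 : fpoly 0 = 1.
Proof. exact: big_geq. Qed.

Lemma fpolyS m : fpoly m.+1 = fpoly m * ('X - (y m.+1)%:P).
Proof. exact: ffactS. Qed.

(** With y_j = 0 for j > n, the factors beyond the n-th are all x. *)
Lemma fpolyD n s : (forall j, (n < j)%N -> y j = 0) ->
  fpoly (n + s) = fpoly n * 'X^s.
Proof.
move=> y0; elim: s => [|s IHs]; first by rewrite addn0 mulr1.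
by rewrite addnS fpolyS IHs y0 ?ltnS ?leq_addr // subr0 -mulrA -exprSr.
Qed.

Lemma uvar_fpoly k (j : 'I_k) m : uvar j (fpoly m) = fpow y 'X_j m.
Proof.
rewrite rmorph_prod; apply: eq_bigr => p _ /=.
by rewrite rmorphB /= uvarX uvarC.
Qed.

(** The exponent of x_j is the part of index k - 1 - j of the partition, plus
    j; reversing rows yields the alternant, and the sign cancels against the one
    in [vandermondeE]. *)
Lemma divsym_fschur k (la : 'I_k -> nat) :
  divsym (\prod_j uvar j (fpoly (la (rev_ord j) + j))) = fschur_symp y la.
Proof.
apply: divsym_unique; apply: (@lreg_sign _ (perm (@rev_ord_inj k))).
rewrite /= mulrCA -vandermondeE fschurE alternation_prod -det_rev_rows.
by congr (\det _); apply/matrixP => i j; rewrite !mxE rev_ordK uvar_fpoly.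
Qed.

End FactorialPowers.

Section Ideal.
Variables (n k' : nat) (L : comNzRingType) (y : nat -> L) (q : L).
Local Notation k := k'.+1.
Local Notation MP := {mpoly L[k]}.
Hypothesis kn : (k <= n)%N.
Hypothesis y0 : forall j, (n < j)%N -> y j = 0.

Local Notation I := (gen_ideal (qH_relations n k y q)).

Lemma ideal_sum J (r : seq J) (P : pred J) (F : J -> sympoly k L) :
  (forall i, P i -> F i \in I) -> \sum_(i <- r | P i) F i \in I.
Proof. exact: rpred_sum. Qed.

Lemma ideal0 : 0 \in I.
Proof. exact: rpred0. Qed.

Lemma idealD a b : a \in I -> b \in I -> a + b \in I.
Proof. exact: rpredD. Qed.

Lemma idealMl a b : a \in I -> a * b \in I.
Proof. by rewrite mulrC; apply: gen_idealMr. Qed.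

(** The products with g in the last variable and the exponents 0, 1, ..., k - 2
    in the others: the image under [divsym] is h_r when g = e_{r+k-1}. *)
Definition last_exponent (g : {poly L}) (j : 'I_k) : {poly L} :=
  if j == ord_max then g else fpoly y j.

Lemma prod_last_exponent (g : {poly L}) : \prod_j uvar j (last_exponent g j) =
  uvar ord_max g * \prod_j uvar j (last_exponent 1 j) :> MP.
Proof.
rewrite !big_ord_recr /= /last_exponent eqxx rmorph1 mulr1 mulrC.
congr (_ * _); apply: eq_bigr => i _.
by rewrite -val_eqE /= (ltn_eqF (ltn_ord i)).
Qed.

(** The coefficient matrix of [divsym_small] is unitriangular up to its last
    diagonal entry. *)
Lemma divsym_last (g : {poly L}) : (size g <= k)%N ->
  divsym (\prod_j uvar j (last_exponent g j)) = (g`_k')%:A :> sympoly k L.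
Proof.
move=> gk; rewrite divsym_small => [|i]; last first.
  by rewrite /last_exponent; case: ifP => // _; rewrite size_fpoly.
congr (_ %:A); rewrite det_trig; last first.
  apply/is_trig_mxP => i j ij; rewrite mxE /last_exponent.
  rewrite -val_eqE (ltn_eqF (leq_trans ij _)) /=; last by rewrite -ltnS.
  by rewrite nth_default // size_fpoly.
rewrite big_ord_recr /= big1 ?mul1r => [|i _]; rewrite mxE /last_exponent.
  by rewrite eqxx.
by rewrite -val_eqE /= (ltn_eqF (ltn_ord i)) fpoly_lead.
Qed.

Lemma hcomplete_divsym r :
  hcomplete k y r = divsym (\prod_j uvar j (last_exponent (fpoly y (r + k')) j)).
Proof.
rewrite /hcomplete -divsym_fschur; congr (divsym _); apply: eq_bigr => j _.
rewrite /last_exponent -val_eqE /= subn_eq0 ltnS.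
have [->|jk] := eqVneq (j : nat) k'; first by rewrite leqnn.
by rewrite leqNgt ltn_neqAle jk -ltnS ltn_ord.
Qed.

(** The polynomial P = e_n - z, which annihilates the cyclic vector v_1 of
    [Xq]. *)
Definition qchar : {poly L} := fpoly y n - ((-1) ^+ k' * q)%:P.

Lemma size_relations : size (qH_relations n k y q) = k.
Proof. by rewrite size_map size_iota. Qed.

(** For r = n - k + 1 + s one has e_{r+k-1} = e_n x^s, which gives h_r; the term
    - z x^s contributes only for s = k - 1, that is r = n, where it is the
    quantum correction (-1)^k q. *)
Lemma relation_divsym s : (s < k)%N ->
  (qH_relations n k y q)`_s =
  divsym (\prod_j uvar j (last_exponent (qchar * 'X^s) j)).
Proof.
move=> sk; rewrite (nth_map 0%N) ?size_iota // nth_iota //.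
rewrite hcomplete_divsym !(prod_last_exponent (_ * _)) prod_last_exponent.
have -> : ((n - k).+1 + s + k' = n + s)%N.
  by rewrite addSnnS addnAC -addnA -addSnnS addnA subnK.
rewrite fpolyD // /qchar mulrBl rmorphB mulrBl linearB /=; congr (_ + _).
rewrite mul_polyC linearZ /= -scalerAl linearZ /= -prod_last_exponent.
rewrite divsym_last ?size_polyXn // coefXn -scaleNr scalerA -mulNr; congr (_ *: _).
rewrite exprS mulN1r; congr (_ * (nat_of_bool _)%:R).
apply/eqP/eqP => [E|<-].
  apply: (@addnI (n - k).+1).
  by rewrite E addSnnS subnK.
by rewrite addSnnS subnK.
Qed.

Lemma relation_in_ideal s : (s < k)%N ->
  divsym (\prod_j uvar j (last_exponent (qchar * 'X^s) j)) \in I.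
Proof.
move=> sk; rewrite -relation_divsym //.
apply/boolp.asboolP; exists (fun i => (i == s)%:R).
have sR : (s < size (qH_relations n k y q))%N by rewrite size_relations.
rewrite (bigD1 (Ordinal sR)) //= eqxx mul1r big1 ?addr0 // => i.
by rewrite -val_eqE /= => /negbTE ->; rewrite mul0r.
Qed.

(** Reduction modulo the monic polynomial prod_i (x - x_i), whose coefficients
    are symmetric and which vanishes at every x_j; the remainder has the same
    value as g at every x_j. *)
Lemma symmetric_reduction (g : {poly L}) :
  exists F : 'I_k -> sympoly k L, forall j,
    uvar j g = \sum_i sympoly_val (F i) * 'X_j ^+ i.
Proof.
pose C : {poly MP} := \prod_(j < k) ('X - ('X_j)%:P).
have szC : size C = k.+1 by rewrite /C -big_enum size_prod_XsubC size_enum_ord.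
have Cs i : C`_i \is symmetric.
  apply/issymP => s; rewrite -coef_map.
  suff -> : map_poly (msym s) C = C by [].
  rewrite /C rmorph_prod /= [RHS](reindex_inj (@perm_inj _ s)) /=.
  apply: eq_bigr => j _; rewrite rmorphB /= map_polyX map_polyC /=.
  by rewrite /msym mmapX mmap1U.
have XE j : 'X_j ^+ k = \sum_(i < k) sympoly_val (- SymPoly (Cs i)) * 'X_j ^+ i.
  have : C.['X_j] = 0.
    by rewrite /C (bigD1 j isT) hornerM hornerXsubC subrr mul0r.
  rewrite horner_coef szC big_ord_recr /=.
  have -> : C`_k = 1.
    have /monicP : C \is monic by apply: monic_prod_XsubC.
    by rewrite /lead_coef szC.
  rewrite mul1r addrC => /eqP; rewrite addr_eq0 => /eqP ->.
  by rewrite -sumrN; apply: eq_bigr => i _; rewrite -mulNr.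
elim/poly_ind: g => [|g c [F FE]].
  by exists (fun=> 0) => j; rewrite rmorph0 big1 // => i _; rewrite mul0r.
exists (fun i => (if i == ord0 then c%:A else 0) +
  (if unlift ord0 i is Some i' then F (widen_ord (leqnSn k') i') else 0)
  + F ord_max * (- SymPoly (Cs i))) => j.
rewrite rmorphD rmorphM /= uvarX uvarC FE.
under [RHS]eq_bigr => i _ do rewrite /= !mulrDl.
rewrite !big_split /= [LHS]addrC -[RHS]addrA; congr (_ + _).
  rewrite (bigD1 ord0) //= big1 ?addr0 ?mulr1 ?alg_mpolyC //.
  by move=> i /negbTE ->; rewrite mul0r.
rewrite big_ord_recr /= mulrDl; congr (_ + _).
  rewrite big_ord_recl unlift_none mul0r add0r big_distrl /=.
  by apply: eq_bigr => i _; rewrite liftK -mulrA -exprSr.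
rewrite -mulrA -exprSr XE big_distrr /=; apply: eq_bigr => i _.
by rewrite mulrA.
Qed.

(** Pairing with x_k^s, the relation of index s equals F_{k-1-s} plus a
    combination of the F_i with i > k - 1 - s, so strong induction on s solves
    for the F_i. *)
Lemma qchar_coefficients (F : 'I_k -> sympoly k L) :
  (forall j, uvar j qchar = \sum_i sympoly_val (F i) * 'X_j ^+ i) ->
  forall i, F i \in I.
Proof.
move=> FE i; rewrite -[i]rev_ordK; move: (rev_ord i) => {i} s.
have [m] := ubnP s; elim: m s => // m IHm s; rewrite ltnS => sm.
have := relation_in_ideal (ltn_ord s).
rewrite prod_last_exponent rmorphM /= FE uvarXn !big_distrl linear_sum /=.
have E i : divsym (sympoly_val (F i) * 'X_ord_max ^+ i * 'X_ord_max ^+ s *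
      \prod_j uvar j (last_exponent 1 j)) =
    F i * divsym (\prod_j uvar j (last_exponent 'X^(i + s) j)).
  by rewrite -divsym_symM (prod_last_exponent 'X^(i + s)) uvarXn exprD !mulrA.
under eq_bigr => i _ do rewrite E.
rewrite (bigD1 (rev_ord s)) //=.
have sk : (s <= k')%N by rewrite -ltnS.
rewrite subSS subnK // divsym_last ?size_polyXn // coefXn eqxx scale1r mulr1.
move=> H; rewrite -(addrK (\sum_(i < k | i != rev_ord s)
  F i * divsym (\prod_j uvar j (last_exponent 'X^(i + s) j))) (F (rev_ord s))).
rewrite rpredB //; apply: ideal_sum => i nis.
have [is_lt|is_ge] := ltnP (i + s) k'.
  rewrite divsym_last ?size_polyXn ?ltnS ?(ltnW is_lt) //.
  by rewrite coefXn (gtn_eqF is_lt) scale0r mulr0 rpred0.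
apply: idealMl; rewrite -[i]rev_ordK; apply: IHm.
have ik : (i <= k')%N by rewrite -ltnS.
rewrite (leq_trans _ sm) //= subSS ltn_subLR // ltn_neqAle is_ge andbT.
apply: contra nis => /eqP kE.
by apply/eqP/val_inj; rewrite /= subSS [X in (X - _)%N](kE) addnK.
Qed.

Lemma divsym_qchar_ideal j h : divsym (uvar j qchar * h) \in I.
Proof.
have [F FE] := symmetric_reduction qchar.
rewrite FE big_distrl linear_sum /=; apply: ideal_sum => i _.
rewrite -mulrA divsym_symM; apply: idealMl.
exact: (qchar_coefficients FE).
Qed.

End Ideal.

(** * Partitions of Grassmannian permutations *)

Section GrassmannianPartitions.
Variables (n k : nat) (hk : (k <= n)%N).

(** The values of a Grassmannian permutation grow by at least one per step;
    this is what makes w_j - j weakly increasing and at most n - k. *)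
Lemma gfun_gap (w : 'S_n) : grassmannian k w -> forall i j : 'I_k, (i <= j)%N ->
  (gfun hk w i + (j - i) <= gfun hk w j)%N.
Proof.
move=> gw i j ij.
have [d] : exists d, d = (j - i)%N by eexists.
elim: d j ij => [|d IHd] j ij dE; rewrite -dE.
  rewrite addn0 (_ : j = i) //; apply/val_inj/eqP.
  by rewrite eqn_leq ij andbT /= -subn_eq0 -dE.
have j'k : (j.-1 < k)%N by rewrite (leq_ltn_trans (leq_pred _)).
have ltij : (i < j)%N by rewrite -subn_gt0 -dE.
have jE : j = j.-1.+1 :> nat by rewrite prednK // (leq_ltn_trans _ ltij).
have ij' : (i <= Ordinal j'k)%N by rewrite /= -ltnS -jE.
have dE' : d = (Ordinal j'k - i)%N.
  by apply: succn_inj; rewrite dE /= {1}jE subSn // -ltnS -jE.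
have := IHd _ ij' dE'; rewrite -dE' addnS => /leq_ltn_trans; apply.
by apply: gfun_lt; rewrite //= -jE.
Qed.

Lemma gfun_ge (w : 'S_n) (j : 'I_k) : grassmannian k w -> (j <= gfun hk w j)%N.
Proof.
move=> gw; have k0 : (0 < k)%N by apply: leq_ltn_trans (ltn_ord j).
have := @gfun_gap w gw (Ordinal k0) j (leq0n _).
by rewrite /= subn0; apply/leq_trans/leq_addl.
Qed.

Lemma gpart_rev (w : 'S_n) (j : 'I_k) : grassmannian k w ->
  (gpart hk w (rev_ord j) + j)%N = gfun hk w j.
Proof. by move=> gw; rewrite /gpart rev_ordK subnK // gfun_ge. Qed.

Lemma gpart_partition (w : 'S_n) : grassmannian k w -> is_partition (gpart hk w).
Proof.
move=> gw; apply/forallP => r; apply/forallP => s; apply/implyP => rs.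
have rs' : (rev_ord s <= rev_ord r)%N by rewrite leq_sub2l.
have gap := gfun_gap gw rs'; have ge := gfun_ge (rev_ord s) gw.
by rewrite /gpart; lia.
Qed.

Lemma gpart_fits (w : 'S_n) : grassmannian k w -> fits k (n - k) (gpart hk w).
Proof.
move=> gw; apply/forallP => r; rewrite (leqNgt k) ltn_ord implyFb andbT.
have lastk : (k.-1 < k)%N by case: (k) r => [[]|].
have rlast : (rev_ord r <= Ordinal lastk)%N by rewrite /= -subn1 leq_sub2l.
have gap := gfun_gap gw rlast; have lt := ltn_ord (gfun hk w (Ordinal lastk)).
by rewrite /gpart; move: gap lt => /=; lia.
Qed.

End GrassmannianPartitions.

(** * The exterior power and the quantum ring *)

Section QuantumProduct.
Variables (n' k' : nat) (L : comNzRingType) (y : nat -> L) (q : L).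
Local Notation n := n'.+1.
Local Notation k := k'.+1.
Hypothesis hk : (k <= n)%N.
Hypothesis y0 : forall j, (n < j)%N -> y j = 0.
Hypothesis kreg : GRing.lreg (k`!%:R : L).

Local Notation X := (Xq n k y q).
Local Notation MP := {mpoly L[k]}.

Lemma psi_delta (a : 'I_n) : psi n k q a.+1 = delta_mx a 0.
Proof.
have an : (a.+1 == n.+1) = false by rewrite eqSS ltn_eqF.
by apply/colP => b; rewrite /psi an !mxE andbT eqSS.
Qed.

Lemma transl_Xq j : transl n k y q j = X - (y j)%:M.
Proof.
apply/matrixP => a b; rewrite !mxE psi_delta !mxE andbT /psi eqSS.
rewrite mulr_natr mulrnBl.
have -> : (a == b) = (b == a) by rewrite eq_sym.
have -> : y b.+1 *+ (b == a) = y a.+1 *+ (b == a) by case: eqVneq => [->|].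
rewrite addrA; do 2 congr (_ + _).
case: ifP => [/eqP bn|bn]; rewrite mxE ?andbT ?andbF.
  by rewrite bn (ltn_eqF (ltn_ord a)) addr0.
by rewrite eqSS mulr0n add0r.
Qed.

Lemma transl_psi m : (m < n)%N ->
  (X - (y m.+1)%:M) *m psi n k q m.+1 = psi n k q m.+2.
Proof.
move=> mn; rewrite -transl_Xq (psi_delta (Ordinal mn)) -colE.
by apply/colP => a; rewrite !mxE /= subrr mul0r addr0.
Qed.

Definition basis1 : 'cV[L]_n := psi n k q 1.

Lemma fpoly_v1 m : (m <= n)%N -> horner_mx X (fpoly y m) *m basis1 = psi n k q m.+1.
Proof.
elim: m => [|m IHm] mn; first by rewrite fpoly0 rmorph1 mul1mx.
rewrite fpolyS mulrC rmorphM -mulmxA IHm ?(ltnW mn) //.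
by rewrite rmorphB /= horner_mx_X horner_mx_C transl_psi.
Qed.

Lemma qchar_v1 : horner_mx X (qchar n k' y q) *m basis1 = 0.
Proof.
rewrite rmorphB mulmxBl fpoly_v1 //= horner_mx_C mul_scalar_mx.
rewrite /basis1 (psi_delta ord0); apply/colP => a; rewrite !mxE /psi eqxx mxE andbT.
by rewrite /zq -val_eqE mulr_natr subrr.
Qed.

(** The map T of the opening comment: it presents the exterior power as a quotient
    of the polynomial ring. *)
Definition eval_v1 : MP -> extpow n L k := wedge_eval X (fun=> basis1).
HB.instance Definition _ := GRing.Linear.on eval_v1.

(** The polynomial E_w, sent by [eval_v1] to |w> and by [divsym] to
    s_{lambda(w)}. *)
Definition basis_monomial (w : 'S_n) : MP := \prod_j uvar j (fpoly y (gfun hk w j)).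

Lemma eval_v1_mul_basis_monomial w p : eval_v1 (p * basis_monomial w) =
  wedge_eval X (fun j => delta_mx (gfun hk w j) 0) p.
Proof.
rewrite /eval_v1 wedge_eval_mul_prod //; congr (wedge_eval X _ p); apply/boolp.funext => j.
by rewrite fpoly_v1 ?psi_delta // ltnW.
Qed.

Lemma tensor_basis_pure (f : {ffun 'I_k -> 'I_n}) :
  tensor_basis L f = pure_tensor (fun j => delta_mx (f j) 0).
Proof.
apply/ffunP => g; rewrite !ffunE; under eq_bigr => j _ do rewrite mxE andbT.
have [->|ngf] := eqVneq g f; first by rewrite big1 // => j _; rewrite eqxx.
have [j] : exists j, g j != f j.
  by apply/existsP; rewrite -negb_forall; apply: contra ngf => /eqfunP/ffunP ->.
by move=> /negbTE gfj; rewrite (bigD1 j) //= gfj mul0r.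
Qed.

Lemma tensor_ext_basis_monomial w p :
  tensor_ext (tensor_poly X p (tensor_basis L (gfun hk w))) =
  eval_v1 (p * basis_monomial w).
Proof. by rewrite tensor_basis_pure tensor_ext_poly // eval_v1_mul_basis_monomial. Qed.

Lemma eval_v1_basis_monomial w : eval_v1 (basis_monomial w) = ket hk L w.
Proof.
rewrite /eval_v1 /basis_monomial wedge_eval_prod //; apply: eq_wedges => j.
by rewrite fpoly_v1 ?psi_delta // ltnW.
Qed.

Lemma divsym_basis_monomial w : grassmannian k w ->
  divsym (basis_monomial w) = fschur_symp y (gpart hk w).
Proof.
move=> gw; rewrite -divsym_fschur; congr (divsym _); apply: eq_bigr => j _.
by rewrite gpart_rev.
Qed.

(** Tableau by tableau, the factor prod (x_j - y_{...}) of [fschur_tableaux] in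
    the variable x_j acts on the j-th wedge factor as the product of the
    translations of the strip. *)
Lemma ostar_basis_eval_v1 u w : grassmannian k u ->
  ostar_basis hk y q u w = eval_v1 (fschur y (gpart hk u) * basis_monomial w).
Proof.
move=> gu; rewrite (fschur_tableaux y (gpart_partition hk gu) (gpart_fits hk gu)).
rewrite big_distrl linear_sum; apply: eq_bigr => T _ /=.
rewrite eval_v1_mul_basis_monomial.
pose g j : {poly L} := \prod_(r < k)
  \prod_(part_pred T (rev_ord j) r <= c < part_succ T (rev_ord j) r)
     ('X - (y (k - j + c - r))%:P).
rewrite [X in wedge_eval _ _ X](_ : _ = \prod_j uvar j (g j)); last first.
  apply: eq_bigr => j _; rewrite rmorph_prod; apply: eq_bigr => r _ /=.
  rewrite rmorph_prod; apply: eq_bigr => c _ /=.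
  by rewrite rmorphB /= uvarX uvarC.
rewrite wedge_eval_prod //; apply: eq_wedges => j; rewrite psi_delta.
congr (_ *m _); rewrite /transl_strip rmorph_prod; apply: eq_bigr => r _ /=.
rewrite rmorph_prod; apply: eq_bigr => c _ /=.
by rewrite transl_Xq rmorphB /= horner_mx_X horner_mx_C.
Qed.

Lemma ostar_qstar x x' : ostar hk y q x x' = qstar hk y q x x'.
Proof.
apply: eq_bigr => u gu; rewrite /ext_poly scaler_sumr; apply: eq_bigr => w gw.
by rewrite scalerA ostar_basis_eval_v1 // tensor_ext_basis_monomial.
Qed.


Lemma eval_v1_msym (s : 'S_k) f : eval_v1 (msym s f) = (-1) ^+ s *: eval_v1 f.
Proof.
elim/mpolyind: f => [|c m f _ _ IHf]; first by rewrite msym0 (linear0 eval_v1) scaler0.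
rewrite msymD msymZ msymX !(linearP eval_v1) /= IHf scalerDr; congr (_ + _).
rewrite scalerA mulrC -scalerA; congr (_ *: _).
rewrite /eval_v1 !wedge_evalX -odd_permV.
rewrite -(wedges_perm hk s^-1%g (fun j => X ^+ m j *m basis1)).
by apply: eq_wedges => j; rewrite mnmE.
Qed.

(** All k! permuted copies contribute equally, since T is antisymmetric. *)
Lemma eval_v1_alternation f : eval_v1 (alternation f) = (k`!)%:R *: eval_v1 f.
Proof.
rewrite (linear_sum eval_v1) /= (eq_bigr (fun=> eval_v1 f)) => [|s _].
  by rewrite sumr_const card_Sn scaler_nat.
rewrite -(rmorph_sign (@mpolyC k L)) mul_mpolyC (linearZ_LR eval_v1) /= eval_v1_msym.
by rewrite scalerA -signr_addb addbb scale1r.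
Qed.

(** If D f = 0 then Alt f = 0, so k! T f = 0. *)
Lemma eval_v1_divsym0 f : divsym f = 0 -> eval_v1 f = 0.
Proof.
move=> f0; have := eval_v1_alternation f; rewrite -divsymE f0 mul0r (linear0 eval_v1).
move=> /esym kf; apply: (extpow_coord_inj (hk := hk)) => w gw.
apply: kreg; rewrite -!coordZ kf; congr (coord _ _ _).
by rewrite scaler0.
Qed.

Lemma wedges0 (v : 'I_k -> 'cV[L]_n) j : v j = 0 -> wedges v = 0.
Proof.
move=> vj; apply: (extpow_coord_inj (hk := hk)) => w gw.
rewrite coord_wedges // (expand_det_col _ j) big1 ?linear0 // => i _.
by rewrite mxE vj mxE mul0r.
Qed.

Lemma eval_v1_qchar j h : eval_v1 (uvar j (qchar n k' y q) * h) = 0.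
Proof.
pose g l : {poly L} := if l == j then qchar n k' y q else 1.
have -> : uvar j (qchar n k' y q) * h = h * \prod_l uvar l (g l).
  rewrite mulrC (bigD1 j) //= big1 => [|l /negbTE nl]; last first.
    by rewrite /g nl rmorph1.
  by rewrite mulr1 /g eqxx.
rewrite /eval_v1 wedge_eval_mul_prod // /wedge_eval big1 // => m _.
rewrite (@wedges0 _ j) ?scaler0 //.
by rewrite /g eqxx qchar_v1 mulmx0.
Qed.

Local Notation I := (gen_ideal (qH_relations n k y q)).

(** Membership in the ideal of those f all of whose multiples are killed by
    T and by D modulo I. *)
Definition negligible (f : MP) :=
  forall h, eval_v1 (f * h) = 0 /\ divsym (f * h) \in I.

Lemma negligible_qchar j : negligible (uvar j (qchar n k' y q)).
Proof. by move=> h; rewrite eval_v1_qchar; split=> //; apply: divsym_qchar_ideal. Qed.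

Lemma negligibleD f g : negligible f -> negligible g -> negligible (f + g).
Proof.
move=> Nf Ng h; have [f1 f2] := Nf h; have [g1 g2] := Ng h.
rewrite mulrDl.
split; first by rewrite (raddfD eval_v1) /= f1 g1 addr0.
by rewrite divsymD (idealD f2 g2).
Qed.

Lemma negligibleM f g : negligible f -> negligible (f * g).
Proof. by move=> Nf h; rewrite -mulrA; apply: Nf. Qed.

Lemma negligible_prod (a b : 'I_k -> MP) :
  (forall j, negligible (a j - b j)) ->
  negligible (\prod_j a j - \prod_j b j).
Proof.
move=> Nab; apply: (big_ind2 (fun u v => negligible (u - v))); last by move=> j _.
  move=> h; rewrite subrr mul0r; split; first exact: raddf0.
  rewrite divsym0; exact: ideal0.
move=> u1 basis1 u2 v2 N1 N2.
have -> : u1 * u2 - basis1 * v2 = (u1 - basis1) * u2 + (u2 - v2) * basis1 by ring.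
by apply: negligibleD; apply: negligibleM.
Qed.

(** Division by [qchar], with the remainder written in the basis of factorial
    powers; multiplication by x sends e_a to e_{a+1} + y_{a+1} e_a, and e_n is
    replaced by z. *)
Lemma fpoly_reduction (p : {poly L}) : exists Q (c : 'I_n -> L),
  p = Q * qchar n k' y q + \sum_a c a *: fpoly y a.
Proof.
pose S p := exists Q (c : 'I_n -> L),
  p = Q * qchar n k' y q + \sum_a c a *: fpoly y a.
have SD p1 p2 : S p1 -> S p2 -> S (p1 + p2).
  move=> [Q1 [c1 ->]] [Q2 [c2 ->]]; exists (Q1 + Q2), (fun a => c1 a + c2 a).
  by rewrite mulrDl addrACA -big_split; under [in RHS]eq_bigr do rewrite scalerDl.
have SZ c p1 : S p1 -> S (c *: p1).
  move=> [Q [d ->]]; exists (c *: Q), (fun a => c * d a).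
  rewrite scalerDr scalerAl scaler_sumr; congr (_ + _).
  by apply: eq_bigr => a _; rewrite scalerA.
have SQ Q : S (Q * qchar n k' y q).
  exists Q, (fun=> 0); rewrite big1 ?addr0 // => a _; exact: scale0r.
have Sf m : (m <= n)%N -> S (fpoly y m).
  rewrite leq_eqVlt => /predU1P[->|mn].
    have -> : fpoly y n = 1 * qchar n k' y q + ((-1) ^+ k' * q) *: fpoly y 0.
      rewrite mul1r fpoly0 -mul_polyC mulr1 /qchar.
      by rewrite subrK.
    apply: SD; [exact: SQ | apply: SZ].
    exists 0, (fun a => (a == ord0)%:R); rewrite mul0r add0r (bigD1 ord0) //=.
    rewrite scale1r big1 ?addr0 // => a /negbTE ->; exact: scale0r.
  exists 0, (fun a => (a == Ordinal mn)%:R).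
  rewrite mul0r add0r (bigD1 (Ordinal mn)) //= eqxx scale1r.
  by rewrite big1 ?addr0 // => a /negbTE ->; rewrite scale0r.
have S0 : S 0 by have := SQ 0; rewrite mul0r.
rewrite -/(S p); elim/poly_ind: p => // p c [Q [d pE]].
apply: (SD); last first.
  rewrite -[c%:P]mulr1 mul_polyC; apply: (SZ).
  by rewrite -(fpoly0 y); apply: (Sf 0%N).
rewrite pE mulrDl; apply: (SD); first by rewrite mulrAC; apply: (SQ).
rewrite big_distrl /=; apply: big_ind => // a _.
rewrite -scalerAl; apply: (SZ).
have -> : fpoly y a * 'X = fpoly y a.+1 + y a.+1 *: fpoly y a.
  by rewrite fpolyS mulrBr [_ * _%:P]mulrC mul_polyC subrK.
by apply: (SD); [exact: Sf | apply: (SZ); apply: (Sf); apply: ltnW].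
Qed.

Local Notation cls := (@gen_class L (sympoly k L) (qH_relations n k y q)).

Lemma qH_class_ideal a b : a - b \in I -> cls a = cls b.
Proof. by move=> abI; apply/eqP; rewrite gen_class_eq. Qed.

Lemma qH_classZ c a : cls (c *: a) = c *: cls a.
Proof. by rewrite -[RHS]/(gen_scale c (cls a)) gen_classZ. Qed.

Lemma qH_classM a b : cls (a * b) = cls a * cls b :> qH n k y q.
Proof. by rewrite -[RHS]/(gen_mul (cls a) (cls b)) gen_classM. Qed.

Lemma qH_classD a b : cls (a + b) = cls a + cls b.
Proof. exact: gen_classD. Qed.

Lemma qH_class0 : cls 0 = 0.
Proof. by apply: (@addrI _ (cls 0)); rewrite -qH_classD !addr0. Qed.

Lemma qH_class_sum J (r : seq J) (P : pred J) F :
  cls (\sum_(i <- r | P i) F i) = \sum_(i <- r | P i) cls (F i).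
Proof. exact: (big_morph cls qH_classD qH_class0). Qed.

(** The map Phi of the opening comment. *)
Definition schubert_map (x : extpow n L k) : qH n k y q :=
  \sum_(w | grassmannian k w) coord hk w x *: schubert hk y q w.

Lemma schubert_map_linear : linear schubert_map.
Proof.
move=> c x x'; rewrite /schubert_map scaler_sumr -big_split; apply: eq_bigr => w _ /=.
by rewrite coordD coordZ scalerDl scalerA.
Qed.

HB.instance Definition _ :=
  GRing.isLinear.Build L (extpow n L k) (qH n k y q) *:%R schubert_map schubert_map_linear.

Lemma schubert_mapD x x' : schubert_map (x + x') = schubert_map x + schubert_map x'.
Proof. exact: raddfD. Qed.

Lemma schubert_mapZ c x : schubert_map (c *: x) = c *: schubert_map x.
Proof. exact: linearZ_LR. Qed.

Lemma schubert_map0 : schubert_map 0 = 0.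
Proof. exact: raddf0. Qed.

Lemma schubert_map_ket w : grassmannian k w -> schubert_map (ket hk L w) = schubert hk y q w.
Proof.
move=> gw; rewrite /schubert_map (bigD1 w) //= coord_ket // eqxx scale1r.
rewrite big1 ?addr0 // => u /andP[gu /negbTE nu].
by rewrite coord_ket // nu scale0r.
Qed.

Lemma eval_v1D f g : eval_v1 (f + g) = eval_v1 f + eval_v1 g.
Proof. exact: raddfD. Qed.

Lemma eval_v1Z c f : eval_v1 (c *: f) = c *: eval_v1 f.
Proof. exact: linearZ_LR. Qed.

Lemma eval_v1_0 : eval_v1 0 = 0.
Proof. exact: raddf0. Qed.

Definition compatible f := schubert_map (eval_v1 f) = cls (divsym f).

Lemma compatible0 : compatible 0.
Proof. by rewrite /compatible eval_v1_0 schubert_map0 divsym0 qH_class0. Qed.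

Lemma compatibleD f g : compatible f -> compatible g -> compatible (f + g).
Proof.
by rewrite /compatible eval_v1D schubert_mapD divsymD qH_classD => -> ->.
Qed.

Lemma compatibleZ c f : compatible f -> compatible (c *: f).
Proof. by rewrite /compatible eval_v1Z schubert_mapZ divsymZ qH_classZ => ->. Qed.

Lemma compatible_negligible f : negligible f -> compatible f.
Proof.
move=> /(_ 1); rewrite mulr1 /compatible => -[-> fI].
by rewrite schubert_map0 -qH_class0; apply/esym/qH_class_ideal; rewrite subr0.
Qed.

(** If two exponents agree both sides vanish by antisymmetry; otherwise sorting
    the exponents costs the same sign on both sides and leads to some E_w. *)
Lemma compatible_fpoly (a : {ffun 'I_k -> 'I_n}) :
  compatible (\prod_j uvar j (fpoly y (a j))).
Proof.
rewrite /compatible.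
have -> : eval_v1 (\prod_j uvar j (fpoly y (a j))) = ext_basis L a.
  rewrite /eval_v1 wedge_eval_prod //; apply: eq_wedges => j.
  by rewrite fpoly_v1 ?psi_delta // ltnW.
case: (boolP (injectiveb a)) => [/injectiveP ainj | /injectivePn[i [j nij aij]]]; last first.
  rewrite (divsym_alternate nij); last by rewrite aij.
  rewrite /ext_basis (wedges_alternate hk nij) ?aij // schubert_map0.
  by rewrite qH_class0.
have Ak : #|[set a j | j : 'I_k]| = k by rewrite card_imset ?card_ord.
have [w gw wE] := grassmannian_exists hk Ak.
have sP j : exists l, a j = gfun hk w l.
  have : a j \in [set gfun hk w l | l : 'I_k] by rewrite -wE imset_f.
  by case/imsetP => l _ ->; exists l.
have [s sE] := boolp.choice sP.
have sinj : injective s.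
  by move=> i j sij; apply: ainj; rewrite !sE sij.
have aE j : a j = gfun hk w (perm sinj j) by rewrite permE.
have -> : ext_basis L a = (-1) ^+ perm sinj *: ket hk L w.
  rewrite /ket /ext_basis -(wedges_perm hk (perm sinj)).
  by apply: eq_wedges => j; rewrite aE.
rewrite schubert_mapZ schubert_map_ket //.
under eq_bigr => j _ do rewrite aE.
rewrite (divsym_perm (fun l => fpoly y (gfun hk w l))) qH_classZ.
by rewrite -/(basis_monomial w) divsym_basis_monomial.
Qed.

(** Modulo negligible polynomials each factor x_j^m of a monomial may be replaced
    by a combination of e_a with a < n. *)
Lemma compatible_all f : compatible f.
Proof.
elim/mpolyind: f => [|c m f _ _ Cf]; first exact: compatible0.
apply: compatibleD Cf; apply: compatibleZ; rewrite -prod_uvarXn.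
have QcP j : exists Qc : {poly L} * ('I_n -> L),
    'X^(m j) = Qc.1 * qchar n k' y q + \sum_a Qc.2 a *: fpoly y a.
  by have [Q [c' E]] := fpoly_reduction 'X^(m j); exists (Q, c').
have [Qc QcE] := boolp.choice QcP.
pose g j : {poly L} := \sum_a (Qc j).2 a *: fpoly y a.
rewrite -[X in compatible X](subrK (\prod_j uvar j (g j))).
apply: compatibleD.
  apply: compatible_negligible; apply: negligible_prod => j.
  rewrite -rmorphB /= QcE addrK rmorphM mulrC.
  by apply: negligibleM; apply: negligible_qchar.
rewrite (eq_bigr (fun j => \sum_a (Qc j).2 a *: uvar j (fpoly y a))); last first.
  by move=> j _; rewrite linear_sum; apply: eq_bigr => a _; rewrite linearZ.
rewrite bigA_distr_bigA /=; apply: big_ind => [||a _]; first exact: compatible0.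
  exact: compatibleD.
by rewrite scaler_prod; apply: compatibleZ; apply: compatible_fpoly.
Qed.

Lemma schubert_map_product u w : grassmannian k u -> grassmannian k w ->
  schubert_map (tensor_ext (tensor_poly X (fschur y (gpart hk u))
                      (tensor_basis L (gfun hk w))))
  = schubert hk y q u * schubert hk y q w.
Proof.
move=> gu gw; rewrite tensor_ext_basis_monomial [LHS]compatible_all.
rewrite -[fschur _ _]/(sympoly_val (fschur_symp y (gpart hk u))).
by rewrite divsym_symM divsym_basis_monomial // qH_classM.
Qed.

Lemma schubert_map_qstar x x' : schubert_map (qstar hk y q x x') = schubert_map x * schubert_map x'.
Proof.
have scaleAl c (a b : qH n k y q) : c *: (a * b) = (c *: a) * b.
  exact: gen_scaleAl.
have scaleAr c (a b : qH n k y q) : c *: (a * b) = a * (c *: b).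
  by rewrite mulrC scaleAl mulrC.
rewrite [schubert_map x]/schubert_map big_distrl /qstar (raddf_sum schubert_map); apply: eq_bigr => u gu /=.
rewrite schubert_mapZ -scaleAl; congr (_ *: _).
rewrite [schubert_map x']/schubert_map big_distrr /ext_poly (raddf_sum schubert_map).
apply: eq_bigr => w gw /=.
by rewrite schubert_mapZ -scaleAr schubert_map_product.
Qed.

Lemma grassmannian1 : grassmannian k (1 : 'S_n).
Proof.
apply/forallP => i; apply/forallP => j; apply/implyP => /andP[ij _].
by rewrite !perm1.
Qed.

Lemma basis_monomial1 : basis_monomial 1 = \prod_j uvar j (last_exponent y (fpoly y k') j).
Proof.
apply: eq_bigr => j _; rewrite ffunE perm1 /last_exponent /=.
by case: eqP => [->|].
Qed.

Lemma divsym_basis_monomial1 : divsym (basis_monomial 1) = 1.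
Proof. by rewrite basis_monomial1 divsym_last ?size_fpoly // fpoly_lead scale1r. Qed.

Lemma schubert1 : schubert hk y q 1 = 1.
Proof.
by rewrite /schubert /qH_class -divsym_basis_monomial ?grassmannian1 // divsym_basis_monomial1.
Qed.

(** The symmetric polynomial p acting on |id>; the map U of the opening comment. *)
Definition act_on_unit (p : sympoly k L) := eval_v1 (sympoly_val p * basis_monomial 1).

(** D takes the same value on f and on D(f) E_id, because D(E_id) = 1. *)
Lemma eval_v1_divsym f : eval_v1 f = act_on_unit (divsym f).
Proof.
apply/eqP; rewrite -subr_eq0; apply/eqP.
have -> : eval_v1 f - act_on_unit (divsym f) = eval_v1 (f - sympoly_val (divsym f) * basis_monomial 1).
  by rewrite (raddfB eval_v1).
apply: eval_v1_divsym0.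
have -> : divsym (f - sympoly_val (divsym f) * basis_monomial 1) =
    divsym f - divsym (sympoly_val (divsym f) * basis_monomial 1) by exact: raddfB.
by rewrite divsym_symM divsym_basis_monomial1 mulr1 subrr.
Qed.

Lemma act_on_unitD p r : act_on_unit (p + r) = act_on_unit p + act_on_unit r.
Proof.
rewrite /act_on_unit -eval_v1D -mulrDl.
by congr (eval_v1 (_ * _)).
Qed.

Lemma act_on_unitZ c p : act_on_unit (c *: p) = c *: act_on_unit p.
Proof. by rewrite /act_on_unit sympoly_valZ -scalerAl eval_v1Z. Qed.

Lemma act_on_unit0 : act_on_unit 0 = 0.
Proof. by apply: (@addrI _ (act_on_unit 0)); rewrite -act_on_unitD !addr0. Qed.

(** A multiple c g of a relation g is D of a multiple of P(x_k), and U o D = T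
    kills it. *)
Lemma act_on_unit_ideal p : p \in I -> act_on_unit p = 0.
Proof.
move=> /boolp.asboolP[c ->].
rewrite (big_morph _ act_on_unitD act_on_unit0) big1 // => i _.
have ik : (i < k)%N.
  by have := ltn_ord i; rewrite [X in (_ < X)%N]size_relations.
rewrite relation_divsym // -divsym_symM -eval_v1_divsym.
by rewrite prod_last_exponent rmorphM /= mulrC -!mulrA eval_v1_qchar.
Qed.

Lemma act_on_unit_schubert w : grassmannian k w ->
  act_on_unit (fschur_symp y (gpart hk w)) = ket hk L w.
Proof. by move=> gw; rewrite -divsym_basis_monomial // -eval_v1_divsym eval_v1_basis_monomial. Qed.

Definition schubert_inv (x : qH n k y q) : extpow n L k := act_on_unit (gen_repr x).

Lemma schubert_invK : cancel schubert_inv schubert_map.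
Proof.
move=> x; rewrite /schubert_inv /act_on_unit [LHS]compatible_all divsym_symM divsym_basis_monomial1.
by rewrite mulr1 gen_class_repr.
Qed.

Lemma schubert_mapK : cancel schubert_map schubert_inv.
Proof.
move=> x.
pose S := \sum_(w | grassmannian k w) coord hk w x *: fschur_symp y (gpart hk w).
have xS : schubert_map x = cls S.
  by rewrite qH_class_sum; apply: eq_bigr => w gw; rewrite qH_classZ.
have -> : schubert_inv (schubert_map x) = act_on_unit S.
  have SI : gen_repr (schubert_map x) - S \in I.
    by rewrite -gen_class_eq gen_class_repr xS.
  by rewrite /schubert_inv -[gen_repr _](subrK S) act_on_unitD (act_on_unit_ideal SI) add0r.
rewrite (big_morph _ act_on_unitD act_on_unit0) [RHS](sum_coord_ket hk).
by apply: eq_bigr => w gw; rewrite act_on_unitZ act_on_unit_schubert.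
Qed.

Lemma schubert_map_bijective : bijective schubert_map.
Proof. exact: Bijective schubert_mapK schubert_invK. Qed.

Lemma schubert_map_ostar x x' : schubert_map (ostar hk y q x x') = schubert_map x * schubert_map x'.
Proof. by rewrite ostar_qstar schubert_map_qstar. Qed.

Lemma ostarA : associative (ostar hk y q).
Proof.
by move=> x1 x2 x3; apply: (can_inj schubert_mapK); rewrite !schubert_map_ostar mulrA.
Qed.

Lemma ostarC : commutative (ostar hk y q).
Proof.
by move=> x x'; apply: (can_inj schubert_mapK); rewrite !schubert_map_ostar mulrC.
Qed.

Lemma schubert_map_ket1 : schubert_map (ket hk L 1) = 1.
Proof. by rewrite schubert_map_ket ?grassmannian1 // schubert1. Qed.

Lemma ostar1 : left_id (ket hk L 1) (ostar hk y q).
Proof.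
by move=> x; apply: (can_inj schubert_mapK); rewrite schubert_map_ostar schubert_map_ket1 mul1r.
Qed.

End QuantumProduct.

(** * Specialisation to Laurent coefficients *)

(** The Laurent ring sits in a field of characteristic zero. *)
Lemma laurent_nat_lreg n m : (0 < m)%N -> GRing.lreg (m%:R : laurent n).
Proof.
move=> m0.
have mv (a : laurent n) : laurent_val (m%:R * a) = m%:R * laurent_val a.
  by rewrite -[LHS]/(val (m%:R * a)) rmorphM rmorph_nat.
have m_neq0 : (m%:R : {fraction {poly {mpoly int[n]}}}) != 0.
  rewrite -(rmorph_nat (@tofrac {poly {mpoly int[n]}})) tofrac_eq0.
  rewrite -(rmorph_nat (@polyC {mpoly int[n]})) polyC_eq0.
  rewrite -(rmorph_nat (@mpolyC n int)) mpolyC_eq0.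
  by rewrite Num.Theory.pnatr_eq0 -lt0n.
move=> a b ab; apply/val_inj/(mulfI m_neq0).
by rewrite -!mv ab.
Qed.

Lemma yvar_out n j : (n < j)%N -> yvar n j = 0.
Proof. by case: j => // j; rewrite ltnS /yvar => nj; rewrite insubN // -leqNgt. Qed.

Theorem theorem3p1 (n k : nat)
    (hn : (2 <= n)%N) (hk1 : (1 <= k)%N) (hkn : (k <= n)%N) :
  [/\ associative (ostar hkn (yvar n) (qvar n)),
      commutative (ostar hkn (yvar n) (qvar n)),
      forall x x' : extpow n (laurent n) k,
        ostar hkn (yvar n) (qvar n) x x' = qstar hkn (yvar n) (qvar n) x x' &
      exists Phi : {linear extpow n (laurent n) k -> qH n k (yvar n) (qvar n)},
        [/\ forall w : 'S_n, grassmannian k w ->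
              Phi (ket hkn (laurent n) w) = schubert hkn (yvar n) (qvar n) w,
            bijective Phi,
            forall x x' : extpow n (laurent n) k,
              Phi (ostar hkn (yvar n) (qvar n) x x') = Phi x * Phi x' &
            exists e : extpow n (laurent n) k,
              [/\ left_id e (ostar hkn (yvar n) (qvar n)),
                  right_id e (ostar hkn (yvar n) (qvar n)) & Phi e = 1]]].
Proof.
case: n k hn hk1 hkn => [//|n'] [//|k'] _ _ hk.
have y0 j := @yvar_out n'.+1 j.
have kreg := @laurent_nat_lreg n'.+1 _ (fact_gt0 k'.+1).
split; [exact: ostarA | exact: ostarC | exact: ostar_qstar |].
exists (schubert_map (yvar n'.+1) (qvar n'.+1) hk); split.
- exact: schubert_map_ket.
- exact: schubert_map_bijective.
- exact: schubert_map_ostar.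
exists (ket hk _ 1); split; [exact: ostar1 | | exact: schubert_map_ket1].
by move=> x; rewrite ostarC // ostar1.
Qed.
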